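(* Let $\mathbf{A}\in\mathbb{R}^{n\times n}$ be symmetric positive semidefinite, let $f\in\mathscr{F}$, let $2\le k\le n$, and let $\boldsymbol{\omega}_1,\dots,\boldsymbol{\omega}_k\sim\mathcal{N}(\mathbf{0},\mathbf{I})$ be independent random vectors in $\mathbb{R}^n$. Then the i-FlexTrace estimator $$\widehat{\mathrm{tr}}_{\mathrm{iFT}}=\frac1k\sum_{i=1}^k\left(\operatorname{tr} f(\widehat{\mathbf{A}}_{-i})+\boldsymbol{\omega}_i^\top\big(f(\mathbf{A})-f(\widehat{\mathbf{A}}_{-i})\big)\boldsymbol{\omega}_i\right)$$ of $\operatorname{tr}(f(\mathbf{A}))$ satisfies $$\operatorname{MSE}\left[\widehat{\mathrm{tr}}_{\mathrm{iFT}}\right]\le\frac2k\,\mathbb{E}\left[\|f(\mathbf{A})-f(\widehat{\mathbf{A}}_{-1})\|_F^2\right]+2\,\mathbb{E}\left[\|f(\widehat{\mathbf{A}}_{-1})-f(\widehat{\mathbf{A}}_{-\{1,2\}})\|_F^2\right].$$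
   Context: $\mathscr{F}$ is the set of functions $f:[0,\infty)\to[0,\infty)$ with $f(0)=0$ that are operator monotone, i.e. $\mathbf{C}\preceq\mathbf{D}$ implies $f(\mathbf{C})\preceq f(\mathbf{D})$ for symmetric positive semidefinite matrices, where $\preceq$ is the Loewner order. For symmetric positive semidefinite $\mathbf{M}=\mathbf{U}\operatorname{diag}(\mu_i)\mathbf{U}^\top$, $f(\mathbf{M})=\mathbf{U}\operatorname{diag}(f(\mu_i))\mathbf{U}^\top$. $\|\cdot\|_F$ is the Frobenius norm. For an estimator $\hat\theta$ of $\theta$, $\operatorname{MSE}[\hat\theta]=\mathbb{E}(\theta-\hat\theta)^2$. $\boldsymbol{\Omega}\in\mathbb{R}^{n\times k}$ is the matrix with columns $\boldsymbol{\omega}_1,\dots,\boldsymbol{\omega}_k$. The Nyström approximation of $\mathbf{A}$ with test matrix $\mathbf{T}$ is $\mathbf{A}\mathbf{T}(\mathbf{T}^\top\mathbf{A}\mathbf{T})^\dagger(\mathbf{A}\mathbf{T})^\top$, with $\dagger$ the Moore–Penrose pseudoinverse. $\widehat{\mathbf{A}}_{-i}$ is the Nyström approximation of $\mathbf{A}$ whose test matrix is $\boldsymbol{\Omega}$ with its $i$-th column removed, and $\widehat{\mathbf{A}}_{-\{1,2\}}$ the one whose test matrix is $\boldsymbol{\Omega}$ with its first two columns removed (an empty test matrix gives the zero matrix). *)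

(* Defs.v *)
From HB Require Import structures.
From mathcomp Require Import all_boot all_order all_algebra.
From mathcomp Require Import all_classical all_reals all_analysis.

Set Implicit Arguments.
Unset Strict Implicit.
Unset Printing Implicit Defensive.

Import Order.TTheory GRing.Theory Num.Theory.

Local Open Scope classical_set_scope.
Local Open Scope ring_scope.

Section Matrices.
Context {R : realType}.

Definition quad_form n (M : 'M[R]_n) (x : 'cV[R]_n) : R :=
  (x^T *m M *m x) ord0 ord0.

Definition psd n (M : 'M[R]_n) : Prop :=
  M^T = M /\ forall x : 'cV[R]_n, 0 <= quad_form M x.

Definition loewner_le n (C D : 'M[R]_n) : Prop := psd (D - C).

Definition frobenius_norm m n (M : 'M[R]_(m, n)) : R :=
  Num.sqrt (\sum_(i < m) \sum_(j < n) M i j ^+ 2).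

Definition eigen_decomposition n (M U : 'M[R]_n) (mu : 'rV[R]_n) : Prop :=
  U *m U^T = 1%:M /\ M = U *m diag_mx mu *m U^T.

(* For symmetric M such a B exists and does not depend on the eigenvalue
   decomposition; for other matrices the value is 0 by convention. *)
Definition matfun (f : R -> R) n (M : 'M[R]_n) : 'M[R]_n :=
  xget 0 [set B | exists U mu, eigen_decomposition M U mu /\
                               B = U *m diag_mx (map_mx f mu) *m U^T].

Definition operator_monotone (f : R -> R) : Prop :=
  forall n (C D : 'M[R]_n), psd C -> psd D ->
    loewner_le C D -> loewner_le (matfun f C) (matfun f D).

(* Only the values of f on [0, +oo[ are constrained: positive semidefinite
   matrices have nonnegative eigenvalues. *)
Definition class_F (f : R -> R) : Prop :=
  [/\ f 0 = 0, forall x, 0 <= x -> 0 <= f x & operator_monotone f].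

Definition is_moore_penrose m n (M : 'M[R]_(m, n)) (X : 'M[R]_(n, m)) : Prop :=
  [/\ M *m X *m M = M, X *m M *m X = X,
      (M *m X)^T = M *m X & (X *m M)^T = X *m M].

(* The four Penrose equations have exactly one solution. *)
Definition pinvmx_MP m n (M : 'M[R]_(m, n)) : 'M[R]_(n, m) :=
  xget 0 [set X | is_moore_penrose M X].

Definition nystrom n p (A : 'M[R]_n) (T : 'M[R]_(n, p)) : 'M[R]_n :=
  A *m T *m pinvmx_MP (T^T *m A *m T) *m (A *m T)^T.

Definition drop_cols n k (D : pred 'I_k) (Om : 'M[R]_(n, k)) :
    'M[R]_(n, #|[predC D]|) :=
  colsub (fun j => enum_val j) Om.

Definition nystrom_drop n k (A : 'M[R]_n) (Om : 'M[R]_(n, k)) (D : pred 'I_k) :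
    'M[R]_n :=
  nystrom A (drop_cols D Om).

Definition iFlexTrace n k (f : R -> R) (A : 'M[R]_n) (Om : 'M[R]_(n, k)) : R :=
  k%:R^-1 * \sum_(i < k)
    (\tr (matfun f (nystrom_drop A Om (pred1 i)))
     + quad_form (matfun f A - matfun f (nystrom_drop A Om (pred1 i)))
                 (col i Om)).

End Matrices.

Section Probability.
Context {R : realType} {d : measure_display} {T : measurableType d}.
Variable P : probability T R.

(* Subfamilies are covered by taking B i = setT for the omitted indices. *)
Definition mutually_independent d' (E : measurableType d') (I : finType)
    (X : I -> T -> E) : Prop :=
  forall B : I -> set E, (forall i, measurable (B i)) ->
    P (\bigcap_i (X i @^-1` B i)) = (\prod_(i : I) fine (P (X i @^-1` B i)))%:E.

(* The law N(0, I) on R^n: independent N(0, 1) coordinates. *)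
Definition standard_normal_vector n (X : {RV P >-> n.-tuple R}) : Prop :=
  (forall (j : 'I_n) (B : set R), measurable B ->
     P ((fun w => tnth (X w) j) @^-1` B) = normal_prob 0 1 B)
  /\ mutually_independent (fun (j : 'I_n) w => tnth (X w) j).

Definition MSE (theta : R) (est : T -> R) : \bar R :=
  'E_P[fun w => (theta - est w) ^+ 2].

(* The n x k matrix whose columns are the random vectors. *)
Definition test_matrix n k (omega : 'I_k -> {RV P >-> n.-tuple R}) (w : T) :
    'M[R]_(n, k) :=
  \matrix_(j < n, i < k) tnth (omega i w) j.

End Probability.

(* Main.v *)
Require Import Defs.
From HB Require Import structures.
From mathcomp Require Import all_boot all_order all_algebra all_fingroup.
From mathcomp Require Import all_classical all_reals all_analysis.
From mathcomp Require Import finmap complex measurable_realfun ring lra.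

(* Write [M_i = f(A) - f(A_{-i})] and [e_i = w_i^T M_i w_i - tr M_i], so that the
   error of the estimator is the average of the [e_i].  Since [M_i] does not depend
   on [w_i], the Gaussian fourth moments give [E e_i^2 = 2 E |M_i|_F^2].  For [i <> j]
   split [M_i = N + D_ij] with [N = f(A) - f(A_{-ij})], and [e_i = g_i + h_i]
   accordingly.  As [g_j] does not depend on [w_i] and [e_i] is centred given the
   other columns, [E e_i g_j = 0]; likewise [E g_i e_j = E g_i g_j = 0].  Hence
   [E e_i e_j = E h_i h_j <= E |D_ij|_F^2 + E |D_ji|_F^2], and exchangeability of the
   columns turns all these expectations into those of the bound.  Operator
   monotonicity is only used to bound [f(A_{-i})] by [f(A)], which makes everything
   integrable, and to see that [f] is monotone, hence Borel: measurability of
   [f(A_{-i})] follows because the functions [g] for which [M |-> g(M)] is measurable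
   on positive semidefinite matrices contain the rational functions without poles
   on [0, +oo[ and are closed under pointwise limits. *)

Set Implicit Arguments.
Unset Strict Implicit.
Unset Printing Implicit Defensive.

Import Order.TTheory GRing.Theory Num.Theory.
Import numFieldNormedType.Exports HBNNSimple.

Local Open Scope classical_set_scope.
Local Open Scope ring_scope.

(** * The spectral theorem for real symmetric matrices *)

(** Applying Cauchy-Schwarz to [e_i e_j] directly would bound the mean squared error by that of a
    single term and lose the factor [1/k]. Removing [g_i] and [g_j] is what leaves a covariance
    governed by the difference matrices alone. The constants come from the Gaussian variance
    [2 |q|_F^2] of a quadratic form: it gives the first factor 2, while for [h_i h_j] it is
    cancelled by the 1/2 of [x y <= (x^2 + y^2) / 2], and the second factor 2 counts the two equal
    expectations that remain. Conditioning on the other columns is expressed without conditional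
    expectations: a function that does not depend on column [i] is one invariant under blanking that
    column, and independence is used as factorisation of expectations. Measurability is delicate
    because [matfun] is defined through some eigenvalue decomposition; closure properties in the
    scalar function avoid any measurable choice of eigenvectors. *)

Section SpectralTheorem.
Context {R : realType}.

(** The complex characteristic polynomial has a root [a]. For a row eigenvector [v], the Hermitian
    form [z] of [M] at [v] is [a] times the positive number [q], and it is its own conjugate because
    [M] is real symmetric; hence [a] is real. *)
Lemma sym_has_eigenvalue n (M : 'M[R]_n.+1) : M^T = M ->
  exists a, eigenvalue M a.
Proof.
move=> symM; pose toC : {rmorphism R -> R[i]} := real_complex R.
have [a] := eigenvalue_closed (map_mx toC M) (ltn0Sn n).
have conjtoC x : (toC x)^* = toC x.
  by apply/CrealP; rewrite complex_real.
move=> /[dup] eva /eigenvalueP [v vM v0].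
pose q := \sum_i v 0 i * (v 0 i)^*.
have q0 : q != 0.
  have [i vi0] : exists i, v 0 i != 0.
    apply/existsP; apply: contra_neqT v0 => /existsPn vz.
    by apply/rowP => i; rewrite mxE; apply/eqP; have := vz i; rewrite negbK.
  rewrite gt_eqF // /q (bigD1 i) //= ltr_wpDr ?mul_conjC_gt0 //.
  by apply: sumr_ge0 => j _; rewrite mul_conjC_ge0.
pose z := \sum_i \sum_j v 0 j * toC (M j i) * (v 0 i)^*.
have zE : z = a * q.
  rewrite /q mulr_sumr; apply: eq_bigr => i _.
  rewrite -mulr_suml mulrA; congr (_ * _).
  have /rowP/(_ i) := vM; rewrite !mxE => <-.
  by apply: eq_bigr => j _; rewrite mxE.
have zC : z^* = z.
  rewrite /z rmorph_sum exchange_big /=; apply: eq_bigr => i _.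
  rewrite rmorph_sum; apply: eq_bigr => j _ /=.
  rewrite !rmorphM /= conjCK conjtoC -[in LHS]symM mxE; ring.
have qC : q^* = q.
  rewrite /q rmorph_sum; apply: eq_bigr => i _ /=.
  by rewrite rmorphM /= conjCK mulrC.
have : a \is Num.real.
  apply/CrealP; apply: (mulIf q0); rewrite -zE -[in RHS]zC zE rmorphM /= qC //.
case: a eva {vM zE} => a b eva; rewrite complex_real => /eqP b0.
exists a; move: eva; rewrite b0 !eigenvalue_root_char.
by rewrite -(map_char_poly toC M) -[Complex a 0]/(toC a) (fmorph_root toC).
Qed.

Lemma sqr_norm_gt0 n (v : 'cV[R]_n) : v != 0 -> 0 < (v^T *m v) 0 0.
Proof.
move=> v0; have [i vi0] : exists i, v i 0 != 0.
  apply/existsP; apply: contra_neqT v0 => /existsPn vz.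
  by apply/colP => i; rewrite mxE; apply/eqP; have := vz i; rewrite negbK.
rewrite mxE (bigD1 i) //= ltr_wpDr //.
  by apply: sumr_ge0 => j _; rewrite mxE -expr2 sqr_ge0.
by rewrite mxE -expr2 lt_def sqr_ge0 sqrf_eq0 vi0.
Qed.

(** The change of basis for deflation: conjugation by [H] moves a unit eigenvector [v] to the first
    basis vector. *)
Lemma orthogonal_first_col n (v : 'cV[R]_n.+1) : (v^T *m v) 0 0 = 1 ->
  exists H : 'M[R]_n.+1, H *m H^T = 1%:M /\ H *m delta_mx 0 0 = v.
Proof.
move=> v1; set e : 'cV[R]_n.+1 := delta_mx 0 0.
have e1 : e^T *m e = 1%:M.
  rewrite /e trmx_delta mul_delta_mx.
  by apply/matrixP => i j; rewrite !ord1 !mxE eqxx.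
have v1' : v^T *m v = 1%:M by rewrite [LHS]mx11_scalar v1.
(* For [v = e] the vector [u] of the reflection vanishes, so the identity is taken instead. *)
have [->|uD] := eqVneq v e.
  by exists 1%:M; rewrite mul1mx trmx1 mul1mx.
pose u := v - e; pose s := (u^T *m u) 0 0.
have s0 : 0 < s by apply: sqr_norm_gt0; rewrite subr_eq0.
have uu : u^T *m u = s%:M by exact: mx11_scalar.
(* The Householder reflection exchanging v and e. *)
pose H := 1%:M - (2 / s) *: (u *m u^T).
have HT : H^T = H.
  by rewrite /H [LHS]linearB /= linearZ /= trmx1 trmx_mul trmxK.
exists H; split.
  have PP : (u *m u^T) *m (u *m u^T) = s *: (u *m u^T).
    by rewrite mulmxA -(mulmxA u) uu mul_mx_scalar -scalemxAl.
  rewrite HT /H mulmxBl mul1mx -scalemxAl mulmxBr mulmx1 -scalemxAr PP.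
  rewrite scalerA divfK ?gt_eqF // scaler_nat mulr2n opprD addrA subrr sub0r.
  by rewrite scalerN opprK subrK.
pose c := (v^T *m e) 0 0.
have veE : v^T *m e = c%:M by exact: mx11_scalar.
have evE : e^T *m v = c%:M.
  by rewrite -[LHS]trmxK trmx_mul trmxK veE tr_scalar_mx.
(* As [v] and [e] are unit vectors, [u^T e = c - 1 = - s / 2], so the reflection sends [e] to
   [e + u = v]. *)
have sE : s = 2 - 2 * c.
  have : u^T *m u = (2 - 2 * c)%:M.
    rewrite /u [(v - e)^T]linearB /= mulmxBl !mulmxBr v1' e1 veE evE.
    by apply/matrixP => i j; rewrite !ord1 !mxE eqxx; ring.
  by rewrite uu => /matrixP/(_ 0 0); rewrite !mxE eqxx.
have ue : u^T *m e = (c - 1)%:M.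
  by rewrite /u [(v - e)^T]linearB /= mulmxBl veE e1 -raddfB.
rewrite /H mulmxBl mul1mx -scalemxAl -mulmxA ue mul_mx_scalar scalerA.
have -> : 2 / s * (c - 1) = -1.
  have -> : c - 1 = - (s / 2) by rewrite sE; field.
  by field; rewrite gt_eqF.
by rewrite scaleN1r opprK /u addrC subrK.
Qed.

Theorem spectral_theorem n (M : 'M[R]_n) : M^T = M ->
  exists U mu, eigen_decomposition M U mu.
Proof.
elim: n M => [|n IHn] M symM.
  by exists 1%:M, 0; split; apply/matrixP => -[].
have [a /eigenvalueP [v0 v0M v0n]] := sym_has_eigenvalue symM.
pose s := Num.sqrt ((v0^T^T *m v0^T) 0 0).
have v0T : v0^T != 0 by rewrite -trmx0 (inj_eq trmx_inj).
have s0 : 0 < s by rewrite sqrtr_gt0 sqr_norm_gt0.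
pose v := s^-1 *: v0^T.
have v1 : (v^T *m v) 0 0 = 1.
  rewrite /v [(_ *: _)^T]linearZ /= -scalemxAl -scalemxAr scalerA mxE.
  rewrite -[X in _ * X](@sqr_sqrtr _ _) -/s.
    by field; rewrite gt_eqF.
  by rewrite ltW ?sqr_norm_gt0.
have Mv : M *m v = a *: v.
  rewrite /v -scalemxAr -[in LHS]symM -trmx_mul v0M [(_ *: _)^T]linearZ /= !scalerA.
  by rewrite mulrC.
have [H [HH He]] := orthogonal_first_col v1.
have HtH : H^T *m H = 1%:M by apply: mulmx1C.
(* [N] is [M] in the new basis: its first column is a multiple of the first basis vector because [v]
   is an eigenvector, its first row by symmetry. Induction applies to the remaining block. *)
pose N : 'M[R]_n.+1 := H^T *m M *m H.
have symN : N^T = N by rewrite /N !trmx_mul trmxK symM mulmxA.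
have Ne : N *m delta_mx 0 0 = a *: (delta_mx 0 0 : 'cV_n.+1).
  by rewrite /N -mulmxA He -mulmxA Mv -scalemxAr -He mulmxA HtH mul1mx.
have Ni0 (i : 'I_n.+1) : N i ord0 = if i == ord0 then a else 0.
  have /colP/(_ i) := Ne; rewrite -colE !mxE eqxx andbT => ->.
  by case: (i == 0); rewrite ?mulr1 ?mulr0.
have N0i (i : 'I_n.+1) : N ord0 i = if i == ord0 then a else 0.
  by rewrite -[in LHS]symN mxE Ni0.
have lsh0 (i : 'I_1) : lshift n i = ord0 :> 'I_n.+1.
  by apply/val_inj; rewrite ord1.
pose D : 'M[R]_n := drsubmx (N : 'M[R]_(1 + n)).
have NE : N = block_mx a%:M 0 0 D :> 'M[R]_(1 + n).
  rewrite -[LHS](@submxK _ 1 n 1 n); congr block_mx; apply/matrixP => i j.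
  - rewrite mxE mxE (lsh0 i) (lsh0 j).
    by rewrite [LHS]Ni0 eqxx !ord1 mxE eqxx mulr1n.
  - by rewrite mxE mxE (lsh0 i) [LHS]N0i mxE.
  - by rewrite mxE mxE (lsh0 j) [LHS]Ni0 mxE.
have symD : D^T = D.
  by rewrite /D trmx_drsub symN.
have [V [nu [VV DE]]] := IHn _ symD.
pose W : 'M[R]_(1 + n) := block_mx 1%:M 0 0 V.
have WT : W^T = block_mx 1%:M 0 0 V^T by rewrite /W tr_block_mx trmx1 !trmx0.
exists (H *m W), (row_mx a%:M nu); split.
  rewrite trmx_mul mulmxA -[H *m W *m _]mulmxA.
  have -> : W *m W^T = 1%:M.
    rewrite WT /W mulmx_block !(mul0mx, mulmx0, mul1mx, addr0, add0r) VV.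
    by rewrite -scalar_mx_block.
  by rewrite mulmx1.
have -> : M = H *m N *m H^T.
  rewrite /N !mulmxA HH mul1mx -!mulmxA HH mulmx1 //.
have -> : N = W *m diag_mx (row_mx a%:M nu : 'rV_(1 + n)) *m W^T.
  rewrite NE {1}DE WT /W diag_mx_row.
  have -> : diag_mx (a%:M : 'rV_1) = a%:M.
    by apply/matrixP => i j; rewrite !ord1 !mxE eqxx !mulr1n.
  by rewrite !mulmx_block !(mul0mx, mulmx0, mul1mx, mulmx1, addr0, add0r).
by rewrite trmx_mul !mulmxA.
Qed.

End SpectralTheorem.

(** * Functions of positive semidefinite matrices *)

Section MatrixFunctions.
Context {R : realType}.
Implicit Types (f g : R -> R).

(** Entrywise the hypothesis says that [W i j] vanishes or that the two diagonal entries agree;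
    either way [f] may be applied to them. *)
Lemma diag_mx_intertwine f m n (W : 'M[R]_(m, n)) (d : 'rV[R]_n)
    (e : 'rV[R]_m) : W *m diag_mx d = diag_mx e *m W ->
  W *m diag_mx (map_mx f d) = diag_mx (map_mx f e) *m W.
Proof.
move=> WE; apply/matrixP => i j; have /matrixP/(_ i j) := WE.
rewrite !mul_mx_diag !mul_diag_mx !mxE.
have [->|wn0] := eqVneq (W i j) 0; first by rewrite !(mul0r, mulr0).
by rewrite mulrC => /(mulIf wn0) ->; rewrite mulrC.
Qed.

(** Independence of the decomposition chosen in [matfun]: two of them differ by [W = V^T U], which
    intertwines the two spectra and hence their images under [f]. *)
Lemma matfunE f n (M U : 'M[R]_n) (mu : 'rV[R]_n) :
  eigen_decomposition M U mu ->
  matfun f M = U *m diag_mx (map_mx f mu) *m U^T.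
Proof.
move=> [UU ME]; rewrite /matfun; case: xgetP => [B _ [V [nu [[VV ME'] ->]]]|].
  have UtU := mulmx1C UU; have VtV := mulmx1C VV.
  pose W := V^T *m U.
  have WE : W *m diag_mx mu = diag_mx nu *m W.
    have : V^T *m M *m U = V^T *m M *m U by [].
    rewrite {1}ME ME' !mulmxA VtV mul1mx -!mulmxA UtU mulmx1 !mulmxA.
    by rewrite -[V^T *m U]/W -mulmxA -/W.
  have WfE := diag_mx_intertwine f WE.
  have : V *m (W *m diag_mx (map_mx f mu)) *m U^T =
         V *m (diag_mx (map_mx f nu) *m W) *m U^T by rewrite WfE.
  by rewrite /W !mulmxA VV mul1mx -!mulmxA UU mulmx1 !mulmxA => ->.
by move=> /(_ (U *m diag_mx (map_mx f mu) *m U^T)) []; exists U, mu.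
Qed.

Lemma quad_formE n (M : 'M[R]_n) (x : 'cV[R]_n) :
  quad_form M x = \sum_i \sum_j M i j * (x i 0 * x j 0).
Proof.
rewrite /quad_form mxE exchange_big; apply: eq_bigr => j _ /=.
rewrite mxE mulr_suml; apply: eq_bigr => i _; rewrite mxE; ring.
Qed.

Lemma psd_congr m n (M : 'M[R]_n) (B : 'M[R]_(n, m)) :
  psd M -> psd (B^T *m M *m B).
Proof.
move=> [symM M0]; split; first by rewrite !trmx_mul trmxK symM mulmxA.
move=> x; have := M0 (B *m x).
by rewrite /quad_form trmx_mul !mulmxA.
Qed.

Lemma psd_congrT m n (M : 'M[R]_n) (B : 'M[R]_(m, n)) :
  psd M -> psd (B *m M *m B^T).
Proof. by move=> /(psd_congr B^T); rewrite trmxK. Qed.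

Lemma psd_diag n (d : 'rV[R]_n) : (forall i, 0 <= d 0 i) -> psd (diag_mx d).
Proof.
move=> d0; split; first by rewrite tr_diag_mx.
move=> x; rewrite quad_formE; apply: sumr_ge0 => i _.
rewrite (bigD1 i) //= big1 ?addr0 => [|j ji].
  by rewrite mxE eqxx mulr1n mulr_ge0 // -expr2 sqr_ge0.
by rewrite mxE eq_sym (negbTE ji) mulr0n mul0r.
Qed.

(** One decomposition serves all [f] at once, which reduces identities between functions of [M] to
    identities on nonnegative eigenvalues. *)
Lemma psd_eigen n (M : 'M[R]_n) : psd M -> exists (U : 'M[R]_n) (mu : 'rV[R]_n),
  [/\ U *m U^T = 1%:M, U^T *m U = 1%:M, forall i, 0 <= mu 0 i,
      M = U *m diag_mx mu *m U^T
    & forall f, matfun f M = U *m diag_mx (map_mx f mu) *m U^T].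
Proof.
move=> psdM; have [symM _] := psdM.
have [U [mu dec]] := spectral_theorem symM.
have [UU ME] := dec; have UtU := mulmx1C UU.
exists U, mu; split => // [i|f]; last exact: matfunE.
have [_ /(_ (delta_mx i 0))] := psd_congr U psdM.
rewrite ME !mulmxA UtU mul1mx -!mulmxA UtU mulmx1 quad_formE.
rewrite (bigD1 i) //= (bigD1 i) //= !big1 ?addr0.
- by rewrite !mxE !eqxx mulr1n !mulr1.
- move=> j ji; rewrite big1 // => k _.
  by rewrite [delta_mx i 0 j 0]mxE (negbTE ji) !(mul0r, mulr0).
- move=> j ji.
  by rewrite [delta_mx i 0 j 0]mxE (negbTE ji) !(mul0r, mulr0).
Qed.

Lemma spec_entry n (U : 'M[R]_n) (d : 'rV[R]_n) i j :
  (U *m diag_mx d *m U^T) i j = \sum_k d 0 k * (U i k * U j k).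
Proof.
rewrite mxE; apply: eq_bigr => k _.
rewrite mul_mx_diag !mxE; ring.
Qed.

Lemma eq_matfun f g n (M : 'M[R]_n) : psd M ->
  (forall x, 0 <= x -> f x = g x) -> matfun f M = matfun g M.
Proof.
move=> /psd_eigen[U [mu [_ _ mu0 _ E]]] fg; rewrite !E.
by congr (_ *m diag_mx _ *m _); apply/rowP => i; rewrite !mxE fg.
Qed.

Lemma matfun_id n (M : 'M[R]_n) : psd M -> matfun id M = M.
Proof.
move=> /psd_eigen[U [mu [_ _ _ ME E]]]; rewrite E [RHS]ME.
by congr (_ *m diag_mx _ *m _); apply/rowP => i; rewrite !mxE.
Qed.

Lemma matfun_cst c n (M : 'M[R]_n) : psd M -> matfun (fun=> c) M = c%:M.
Proof.
move=> /psd_eigen[U [mu [UU _ _ _ E]]]; rewrite E.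
have -> : map_mx (fun=> c) mu = const_mx c by apply/rowP => i; rewrite !mxE.
by rewrite diag_const_mx mul_mx_scalar -scalemxAl UU scalemx1.
Qed.

Lemma matfunD f g n (M : 'M[R]_n) : psd M ->
  matfun (fun x => f x + g x) M = matfun f M + matfun g M.
Proof.
move=> /psd_eigen[U [mu [_ _ _ _ E]]]; rewrite !E; apply/matrixP => i j.
rewrite [RHS]mxE !spec_entry -big_split; apply: eq_bigr => k _ /=.
by rewrite !mxE mulrDl.
Qed.

Lemma matfunM f g n (M : 'M[R]_n) : psd M ->
  matfun (fun x => f x * g x) M = matfun f M *m matfun g M.
Proof.
move=> /psd_eigen[U [mu [_ UtU _ _ E]]]; rewrite !E.
rewrite -!mulmxA [U^T *m (U *m _)]mulmxA UtU mul1mx; congr (_ *m _).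
rewrite [RHS]mulmxA mulmx_diag; congr (diag_mx _ *m _).
by apply/rowP => i; rewrite !mxE.
Qed.

Lemma matfun_sym f n (M : 'M[R]_n) : psd M -> (matfun f M)^T = matfun f M.
Proof.
move=> /psd_eigen[U [mu [_ _ _ _ E]]]; rewrite !E.
by rewrite !trmx_mul trmxK tr_diag_mx mulmxA.
Qed.

Lemma matfun_psd f n (M : 'M[R]_n) : psd M ->
  (forall x, 0 <= x -> 0 <= f x) -> psd (matfun f M).
Proof.
move=> /psd_eigen[U [mu [_ _ mu0 _ E]]] f0; rewrite E.
by apply/psd_congrT/psd_diag => i; rewrite mxE f0.
Qed.

Lemma matfunV f n (M : 'M[R]_n) : psd M -> (forall x, 0 <= x -> f x != 0) ->
  matfun f M \in unitmx /\ matfun (fun x => (f x)^-1) M = invmx (matfun f M).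
Proof.
move=> psdM f0.
have E : matfun f M *m matfun (fun x => (f x)^-1) M = 1%:M.
  rewrite -matfunM // -(matfun_cst 1 psdM); apply: eq_matfun => // x x0.
  by rewrite divff // f0.
have [uM _] := mulmx1_unit E; split=> //.
by rewrite -[LHS](mulKmx uM) E mulmx1.
Qed.

Lemma cvg_matfun (f_ : nat -> R -> R) f n (M : 'M[R]_n) i j : psd M ->
  (forall x, 0 <= x -> (fun m => f_ m x) @ \oo --> f x) ->
  (fun m => matfun (f_ m) M i j) @ \oo --> matfun f M i j.
Proof.
move=> /psd_eigen[U [mu [_ _ mu0 _ E]]] cf.
rewrite (_ : (fun m => _) = (fun m => \sum_k f_ m (mu 0 k) * (U i k * U j k))).
  rewrite E spec_entry; apply: cvg_big => [|k _]; first exact: add_continuous.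
  by apply: cvgMr_tmp; rewrite mxE; exact: cf.
apply/funext => m; rewrite E spec_entry; apply: eq_bigr => k _.
by rewrite mxE.
Qed.

(** [M X] and [M Y] are symmetric projections with the same range, [X M] and [Y M] symmetric
    projections with the same kernel; so they coincide in pairs. *)
Lemma moore_penrose_unique m n (M : 'M[R]_(m, n)) X Y :
  is_moore_penrose M X -> is_moore_penrose M Y -> X = Y.
Proof.
move=> [MXM XMX MXs XMs] [MYM YMY MYs YMs].
have E1 : M *m X = M *m Y.
  have : M *m Y *m (M *m X) = M *m X by rewrite mulmxA MYM.
  rewrite -{1}MXs -{1}MYs -trmx_mul mulmxA MXM MYs.
  by move=> ->.
have E2 : X *m M = Y *m M.
  have : X *m M *m (Y *m M) = X *m M by rewrite -mulmxA [M *m (Y *m M)]mulmxA MYM.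
  rewrite -{1}XMs -{1}YMs -trmx_mul -mulmxA [M *m (X *m M)]mulmxA MXM YMs.
  by move=> ->.
by rewrite -XMX E2 -mulmxA E1 mulmxA YMY.
Qed.

(** By the convention [0^-1 = 0], applying [GRing.inv] to the spectrum inverts the nonzero
    eigenvalues and keeps the zero ones. This puts the pseudoinverse under the functional calculus,
    from which its measurability follows. *)
Lemma pinvmx_psd n (S : 'M[R]_n) : psd S ->
  [/\ pinvmx_MP S = matfun GRing.inv S, is_moore_penrose S (pinvmx_MP S)
    & psd (pinvmx_MP S)].
Proof.
move=> psdS.
have idS := matfun_id psdS.
have MP : is_moore_penrose S (matfun GRing.inv S).
  have SX : S *m matfun GRing.inv S = matfun (fun x => x * x^-1) S.
    by rewrite matfunM // idS.
  have XS : matfun GRing.inv S *m S = matfun (fun x => x^-1 * x) S.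
    by rewrite matfunM // idS.
  split; rewrite ?SX ?XS ?matfun_sym //.
  - rewrite -{2 3}idS -matfunM //; apply: eq_matfun => // x _.
    by have [->|x0] := eqVneq x 0; rewrite ?mulr0 // mulfVK.
  - rewrite -matfunM //; apply: eq_matfun => // x _.
    by have [->|x0] := eqVneq x 0; rewrite ?invr0 ?mulr0 // mulVf ?mul1r.
have E : pinvmx_MP S = matfun GRing.inv S.
  rewrite /pinvmx_MP; case: xgetP => [X _ MPX|/(_ _ MP)//].
  exact: moore_penrose_unique MPX MP.
rewrite E; split=> //; apply: matfun_psd => // x x0.
by rewrite invr_ge0.
Qed.

Lemma gram_psd n p (A : 'M[R]_n) (T : 'M[R]_(n, p)) :
  psd A -> psd (T^T *m A *m T).
Proof. exact: psd_congr. Qed.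

Lemma nystrom_psd n p (A : 'M[R]_n) (T : 'M[R]_(n, p)) :
  psd A -> psd (nystrom A T).
Proof.
by move=> /(gram_psd T)/pinvmx_psd[_ _ ?]; apply: psd_congrT.
Qed.

(** With [Y = T X T^T] the approximation is [A Y A], and [Y A Y = Y]; so [A - A Y A] is the
    congruence of [A] by [1 - Y A]. *)
Lemma nystrom_le n p (A : 'M[R]_n) (T : 'M[R]_(n, p)) :
  psd A -> loewner_le (nystrom A T) A.
Proof.
move=> psdA; have [symA _] := psdA.
have [_ [_ XSX _ _] [symX _]] := pinvmx_psd (gram_psd T psdA).
rewrite /loewner_le /nystrom; set X := pinvmx_MP _ in XSX symX *.
pose Y := T *m X *m T^T.
have symY : Y^T = Y by rewrite /Y !trmx_mul trmxK symX mulmxA.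
have YAY : Y *m A *m Y = Y.
  rewrite /Y -[in RHS]XSX !mulmxA; congr (_ *m _).
have -> : A *m T *m X *m (A *m T)^T = A *m Y *m A.
  by rewrite trmx_mul symA /Y !mulmxA.
have -> : A - A *m Y *m A = (1%:M - Y *m A)^T *m A *m (1%:M - Y *m A).
  rewrite [(_ - _)^T]linearB /= trmx1 trmx_mul symA symY.
  have E : A *m Y *m (A *m Y *m A) = A *m Y *m A by rewrite -[in RHS]YAY !mulmxA.
  rewrite -[RHS]mulmxA [A *m (1%:M - _)]mulmxBr mulmx1 [A *m (Y *m A)]mulmxA.
  rewrite [RHS]mulmxBl mul1mx.
  by rewrite [A *m Y *m (A - _)]mulmxBr E subrr subr0.
exact: psd_congr.
Qed.

(** The form of [B] at [e_i + e_j] and [e_i - e_j] bounds [B i j] by the diagonal of [B], and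
    diagonals are monotone in the Loewner order. *)
Lemma psd_entry_le n (B C : 'M[R]_n) i j : psd B -> loewner_le B C ->
  `|B i j| <= C i i + C j j.
Proof.
have qdelta (M : 'M[R]_n) k : quad_form M (delta_mx k 0) = M k k.
  by rewrite /quad_form trmx_delta -rowE -colE !mxE.
have qdelta2 (M : 'M[R]_n) c : quad_form M (delta_mx i 0 + c *: delta_mx j 0) =
    M i i + c * M i j + c * M j i + c ^+ 2 * M j j.
  rewrite /quad_form [(_ + _)^T]linearD /= [(_ *: _)^T]linearZ /= !trmx_delta.
  rewrite !mulmxDl !mulmxDr -!scalemxAl -!scalemxAr -!rowE -!colE !mxE.
  ring.
move=> [symB B0] [_ CB0].
have le k : B k k <= C k k by have := CB0 (delta_mx k 0); rewrite qdelta !mxE subr_ge0.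
have ge k : 0 <= B k k by have := B0 (delta_mx k 0); rewrite qdelta.
have := B0 (delta_mx i 0 + 1 *: delta_mx j 0).
have := B0 (delta_mx i 0 + (-1) *: delta_mx j 0).
have sB : B j i = B i j by rewrite -{1}symB mxE.
rewrite !qdelta2 sB => p1 p2.
have := le i; have := le j; have := ge i; have := ge j => *.
rewrite ler_norml; lra.
Qed.

(** This is operator monotonicity for matrices of size 1. *)
Lemma class_F_homo f x y : class_F f -> 0 <= x -> x <= y -> f x <= f y.
Proof.
move=> [_ _ mono] x0 xy.
have psds (z : R) : 0 <= z -> psd (z%:M : 'M[R]_1).
  by move=> z0; rewrite -diag_const_mx; apply: psd_diag => i; rewrite mxE.
have mE (z : R) : matfun f (z%:M : 'M[R]_1) = (f z)%:M.
  rewrite (@matfunE f _ _ 1%:M (const_mx z)).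
    by rewrite map_const_mx diag_const_mx mul1mx trmx1 mulmx1.
  by split; rewrite trmx1 !mulmx1 // diag_const_mx mul1mx.
have y0 := le_trans x0 xy.
have := mono 1%N _ _ (psds x x0) (psds y y0).
rewrite /loewner_le -raddfB /= !mE -raddfB /= => /(_ _)[|_ /(_ 1%:M)].
  by apply: psds; rewrite subr_ge0.
by rewrite /quad_form trmx1 mul1mx mulmx1 mxE eqxx mulr1n subr_ge0.
Qed.

Lemma matfun_nystrom_bounds f n p (A : 'M[R]_n) (T : 'M[R]_(n, p)) :
  class_F f -> psd A ->
  psd (matfun f (nystrom A T)) /\
  loewner_le (matfun f (nystrom A T)) (matfun f A).
Proof.
move=> [_ f0 mono] psdA; split; first exact: matfun_psd (nystrom_psd T psdA) f0.
exact: mono (nystrom_psd T psdA) psdA (nystrom_le T psdA).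
Qed.

End MatrixFunctions.

(** * Measurability of the functional calculus *)

Section MeasurableMatrices.
Context {R : realType} {d : measure_display} {T : measurableType d}.

Definition measurable_mx m n (M : T -> 'M[R]_(m, n)) :=
  forall i j, measurable_fun setT (fun w => M w i j).

Lemma measurable_mx_cst m n (M : 'M[R]_(m, n)) : measurable_mx (fun=> M).
Proof. by move=> i j; exact: measurable_cst. Qed.

Lemma measurable_mxD m n (M N : T -> 'M[R]_(m, n)) :
  measurable_mx M -> measurable_mx N -> measurable_mx (fun w => M w + N w).
Proof.
move=> mM mN i j; under eq_fun do rewrite mxE.
exact: measurable_funD.
Qed.

Lemma measurable_mxM m n p (M : T -> 'M[R]_(m, n)) (N : T -> 'M[R]_(n, p)) :
  measurable_mx M -> measurable_mx N -> measurable_mx (fun w => M w *m N w).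
Proof.
move=> mM mN i j; under eq_fun do rewrite mxE.
by apply: measurable_sum => k; exact: measurable_funM.
Qed.

Lemma measurable_mx_tr m n (M : T -> 'M[R]_(m, n)) :
  measurable_mx M -> measurable_mx (fun w => (M w)^T).
Proof. by move=> mM i j; under eq_fun do rewrite mxE; exact: mM. Qed.

Lemma measurable_mx_det n (M : T -> 'M[R]_n) :
  measurable_mx M -> measurable_fun setT (fun w => \det (M w)).
Proof.
move=> mM; apply: measurable_sum => s; apply: measurable_funM => //.
by apply: measurable_prod => i _; exact: mM.
Qed.

(** The continuous functions [x / (x^2 + 1 / (m + 1))] converge pointwise to the inverse, including
    its value 0 at 0. *)
Lemma measurable_inv : measurable_fun setT (@GRing.inv R).
Proof.
pose h (m : nat) (x : R) := x * (x ^+ 2 + m.+1%:R^-1)^-1.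
apply: (@measurable_fun_cvg _ _ _ _ h) => [m|x _].
  apply: measurable_funM => //; apply: continuous_measurable_fun => x.
  apply: cvgV; first by rewrite gt_eqF // ltr_wpDl ?sqr_ge0 ?invr_gt0.
  by apply: cvgD; [exact: exprn_continuous|exact: cvg_cst].
have [->|x0] := eqVneq x 0.
  rewrite invr0 (_ : h ^~ 0 = fun=> 0); first exact: cvg_cst.
  by apply/funext => m; rewrite /h mul0r.
have -> : x^-1 = x * (x ^+ 2 + 0)^-1 by field.
apply: cvgMl_tmp; apply: cvgV; first by rewrite addr0 sqrf_eq0.
by apply: cvgD; [exact: cvg_cst|exact: cvg_harmonic].
Qed.

(** By the cofactor formula the entries of the inverse are polynomials in those of [M], divided by
    the determinant. *)
Lemma measurable_mx_inv n (M : T -> 'M[R]_n) : measurable_mx M ->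
  (forall w, M w \in unitmx) -> measurable_mx (fun w => invmx (M w)).
Proof.
move=> mM uM i j.
under eq_fun do rewrite /invmx uM !mxE.
apply: measurable_funM.
  exact: measurableT_comp measurable_inv (measurable_mx_det mM).
apply: measurable_funM => //; apply: measurable_mx_det => k l.
by under eq_fun do rewrite !mxE; exact: mM.
Qed.

End MeasurableMatrices.

Section MeasurableFunctionalCalculus.
Context {R : realType} {d : measure_display} {T : measurableType d}.
Variables (n : nat) (M : T -> 'M[R]_n).
Hypotheses (psdM : forall w, psd (M w)) (mM : measurable_mx M).

Let calc (g : R -> R) := measurable_mx (fun w => matfun g (M w)).

Let calc_ext (g h : R -> R) : (forall x, 0 <= x -> g x = h x) -> calc g -> calc h.
Proof.
move=> gh cg i j; rewrite (_ : (fun w => _) = (fun w => matfun g (M w) i j)) //.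
by apply/funext => w; rewrite (eq_matfun (psdM w) gh).
Qed.

Let calc_lim (g_ : nat -> R -> R) (g : R -> R) : (forall m, calc (g_ m)) ->
  (forall x, 0 <= x -> (fun m => g_ m x) @ \oo --> g x) -> calc g.
Proof.
move=> cg_ gg i j.
apply: (@measurable_fun_cvg _ _ _ _ (fun m w => matfun (g_ m) (M w) i j)).
  by move=> m; exact: cg_.
by move=> w _; exact: cvg_matfun.
Qed.

Let calc_cst c : calc (fun=> c).
Proof.
move=> i j; under eq_fun do rewrite matfun_cst //.
exact: measurable_cst.
Qed.

Let calcD g h : calc g -> calc h -> calc (fun x => g x + h x).
Proof.
move=> cg ch i j; under eq_fun do rewrite matfunD //.
exact: measurable_mxD.
Qed.

Let calcM g h : calc g -> calc h -> calc (fun x => g x * h x).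
Proof.
move=> cg ch i j; under eq_fun do rewrite matfunM //.
exact: measurable_mxM.
Qed.

Let calcV (g : R -> R) : (forall x, 0 <= x -> g x != 0) -> calc g ->
  calc (fun x => (g x)^-1).
Proof.
move=> g0 cg i j; under eq_fun do rewrite (matfunV (psdM _) g0).2 //.
by apply: measurable_mx_inv => // w; have [] := matfunV (psdM w) g0.
Qed.

Let calcX m : calc (fun x => x ^+ m).
Proof.
elim: m => [|m IHm]; first exact: calc_cst.
apply: (@calc_ext (fun x => x * x ^+ m)) => [x _|]; first by rewrite exprS.
apply: calcM => // i j; under eq_fun do rewrite matfun_id //.
exact: mM.
Qed.

Let calc_sum (I : Type) (r : seq I) (g : I -> R -> R) :
  (forall i, calc (g i)) -> calc (fun x => \sum_(i <- r) g i x).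
Proof.
move=> cg; elim: r => [|i r IHr].
  by apply: (@calc_ext (fun=> 0)) => // x _; rewrite big_nil.
apply: (@calc_ext (fun x => g i x + \sum_(i <- r) g i x)); last exact: calcD.
by move=> x _; rewrite big_cons.
Qed.

(* The smooth cut-offs 1 / (1 + (x / a) ^ m) tend to the indicator of [0, a[,
   up to the value 1 / 2 at a. *)
Let calc_half_step (a : R) : 0 < a ->
  calc (fun x => if x < a then 1 else if x == a then 2^-1 else 0).
Proof.
move=> a0.
apply: (@calc_lim (fun m x => (1 + (a^-1) ^+ m * x ^+ m)^-1)) => [m|x x0].
  apply: calcV => [x x0|].
    by rewrite gt_eqF // ltr_pwDl // mulr_ge0 // exprn_ge0 // invr_ge0 ltW.
  by apply: calcD => //; exact: calcM.
have -> : (fun m => (1 + a^-1 ^+ m * x ^+ m)^-1) =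
          (fun m => (1 + (a^-1 * x) ^+ m)^-1).
  by apply/funext => m; rewrite exprMn.
have [xa|ax|->] := ltgtP x a.
- suff : (fun m => (1 + (a^-1 * x) ^+ m)^-1) @ \oo --> ((1 + 0)^-1 : R).
    by rewrite addr0 invr1.
  apply: cvgV; first by rewrite addr0.
  apply: cvgD; first exact: cvg_cst.
  apply: cvg_expr; rewrite ger0_norm ?mulr_ge0 ?invr_ge0 ?(ltW a0) //.
  by rewrite mulrC ltr_pdivrMr // mul1r.
- have xp : 0 < x by exact: lt_trans ax.
  have -> : (fun m => (1 + (a^-1 * x) ^+ m)^-1) =
            (fun m => (a / x) ^+ m * ((a / x) ^+ m + 1)^-1).
    apply/funext => m.
    have -> : a^-1 * x = (a / x)^-1 by rewrite invf_div mulrC.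
    rewrite exprVn; field; rewrite !gt_eqF ?addr_gt0 ?exprn_gt0 ?divr_gt0 //.
  have c0 : (fun m => (a / x) ^+ m) @ \oo --> (0 : R).
    apply: cvg_expr; rewrite ger0_norm ?divr_ge0 // ?(ltW a0) //.
    by rewrite ltr_pdivrMr // mul1r.
  suff : (fun m => (a / x) ^+ m * ((a / x) ^+ m + 1)^-1) @ \oo -->
      (0 * (0 + 1)^-1 : R) by rewrite mul0r.
  apply: cvgM => //; apply: cvgV; first by rewrite add0r oner_eq0.
  by apply: cvgD => //; exact: cvg_cst.
- rewrite mulVf ?gt_eqF //.
  under eq_fun do rewrite expr1n.
  have -> : 1 + 1 = 2 :> R by ring.
  exact: cvg_cst.
Qed.

(** Half steps at points [b m < a] tending to [a] remove the value at the jump: [x < a] is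
    eventually below [b m], while [x >= a] is above every [b m]. The denominator [m.+2] keeps [b m]
    positive. *)
Let calc_step a : calc (\1_[set x | x < a]).
Proof.
have [a0|a0] := leP a 0.
  apply: (@calc_ext (fun=> 0)) => // x x0; rewrite indicE memNset //=.
  by apply/negP; rewrite -leNgt (le_trans a0).
pose b m : R := a - a * m.+2%:R^-1.
have b0 m : 0 < b m.
  rewrite /b subr_gt0 -[ltRHS]mulr1 ltr_pM2l // invf_lt1 ?ltr1n //.
have ba m : b m < a by rewrite /b ltrBlDr ltrDl mulr_gt0 // invr_gt0.
have cb : b @ \oo --> a.
  suff : b @ \oo --> a - a * 0 by rewrite mulr0 subr0.
  apply: cvgB; first exact: cvg_cst.
  apply: cvgMl_tmp.
  by have := @cvg_harmonic R; rewrite -cvg_shiftS.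
apply: (@calc_lim _ _ (fun m => calc_half_step (b0 m))) => x x0.
rewrite indicE; have [xa|ax] := ltP x a.
  rewrite mem_set //=; apply: cvg_near_cst.
  have : \forall m \near \oo, x < b m by apply: cvgr_gt cb _ xa.
  by apply: filterS => m ->.
rewrite memNset /=; last by apply/negP; rewrite -leNgt.
apply: cvg_near_cst; apply: nearW => m.
have bx := lt_le_trans (ba m) ax.
by rewrite ltNge (ltW bx) /= gt_eqF.
Qed.

(** Dynkin's theorem: open half-lines are stable under intersection and generate the Borel sets.
    Complements use [1 - 1_S]; disjoint unions use partial sums of indicators, which are eventually
    constant at each point. *)
Let calc_indic (B : set R) : measurable B -> calc (\1_B).
Proof.
have mE : @measurable _ (measurableTypeR R) = <<s @RGenInftyO.G R >>.
  exact: RGenInftyO.measurableE.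
move=> mB; have {mB} : <<s @RGenInftyO.G R >> B by rewrite -mE.
apply: (dynkin_induction (P := fun B => calc (\1_B)) mE).
- move=> _ _ [a ->] [b ->]; exists (Num.min a b).
  by apply/seteqP; split=> x /=; rewrite !in_itv /= lt_min => /andP.
- by apply: (@calc_ext (fun=> 1)) => // x _; rewrite indicT.
- move=> _ [a ->]; rewrite set_itvE; exact: calc_step.
- move=> S _ cS; apply: (@calc_ext (fun x => 1 + (-1) * \1_S x)).
    by move=> x _; rewrite indicC indicE; case: (x \in S) => /=; ring.
  by apply: calcD => //; exact: calcM.
- move=> F _ tF cF.
  apply: (@calc_lim (fun m x => \sum_(k <- iota 0 m) \1_(F k) x)).
    by move=> m; exact: calc_sum.
  move=> x _; apply: cvg_near_cst.
  have [[k _ Fkx]|NFx] := pselect ((\bigcup_k F k) x).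
    exists k.+1 => // m /= km; rewrite [RHS]indicE mem_set; last by exists k.
    rewrite (bigD1_seq k) ?mem_iota ?iota_uniq //= indicE mem_set //.
    rewrite big1 ?addr0 // => j jk; rewrite indicE memNset // => Fjx.
    by move/eqP: jk; apply; apply: tF => //; exists x.
  apply: nearW => m; rewrite [RHS]indicE memNset // big1 // => j _.
  by rewrite indicE memNset // => Fjx; apply: NFx; exists j.
Qed.

Lemma measurable_matfun (g : R -> R) : (forall x, 0 <= x -> 0 <= g x) ->
  measurable_fun setT g -> measurable_mx (fun w => matfun g (M w)).
Proof.
(* The approximation by simple functions asks for nonnegativity on the whole line, which [g] has on
   the half-line only; the absolute value changes nothing on the spectrum. *)
move=> g0 mg; apply: (@calc_ext (fun x => `|g x|)) => [x /g0/ger0_norm //|].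
have [||h [_ hg]] := @approximation _ _ R setT measurableT
  (fun x => `|g x|%:E).
- by apply/measurable_EFinP; exact: measurableT_comp mg.
- by move=> x _; rewrite lee_fin.
apply: (@calc_lim (fun m x => h m x) (fun x => `|g x|)) => [m|x x0]; last first.
  by have /fine_cvgP[] := hg x I.
apply: (@calc_ext (fun x =>
    \sum_(y <- fset_set (range (h m))) y * \1_(h m @^-1` [set y]) x)).
  by move=> x _; rewrite fimfunE fsbig_finite.
apply: calc_sum => i; apply: calcM => //; apply: calc_indic.
exact: measurable_sfunP.
Qed.

End MeasurableFunctionalCalculus.

(** * Moments of the normal distribution *)

Section RealIntegrable.
Context {d : measure_display} {T : measurableType d} {R : realType}.
Variable mu : {measure set T -> \bar R}.
Implicit Types f g : T -> R.

Lemma integrable_dominated g f : measurable_fun setT f ->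
  (forall x, `|f x| <= g x) -> mu.-integrable setT (EFin \o g) ->
  mu.-integrable setT (EFin \o f).
Proof.
move=> mf fg; apply: le_integrable => //; first exact/measurable_EFinP.
by move=> x _ /=; rewrite lee_fin (le_trans (fg x)) // ler_norm.
Qed.

Lemma integrable_realD f g : mu.-integrable setT (EFin \o f) ->
  mu.-integrable setT (EFin \o g) ->
  mu.-integrable setT (EFin \o (fun x => f x + g x)).
Proof. by move=> If Ig; exact: (integrableD measurableT If Ig). Qed.

Lemma integrable_realZ c f : mu.-integrable setT (EFin \o f) ->
  mu.-integrable setT (EFin \o (fun x => c * f x)).
Proof. by move=> If; exact: (integrableZl measurableT c If). Qed.

Lemma integrable_realB f g : mu.-integrable setT (EFin \o f) ->
  mu.-integrable setT (EFin \o g) ->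
  mu.-integrable setT (EFin \o (fun x => f x - g x)).
Proof. by move=> If Ig; exact: (integrableB measurableT If Ig). Qed.

Lemma integrable_real_sum (I : Type) (r : seq I) (p : pred I) (f : I -> T -> R) :
  (forall i, p i -> mu.-integrable setT (EFin \o f i)) ->
  mu.-integrable setT (EFin \o (fun x => \sum_(i <- r | p i) f i x)).
Proof.
move=> If; rewrite (_ : _ \o _ = fun x => (\sum_(i <- r | p i) (f i x)%:E)%E).
  exact: integrable_sum.
by apply/funext => x /=; rewrite sumEFin.
Qed.

Lemma Rintegral_sum (I : Type) (r : seq I) (p : pred I) (f : I -> T -> R) :
  (forall i, p i -> mu.-integrable setT (EFin \o f i)) ->
  \int[mu]_x (\sum_(i <- r | p i) f i x) = \sum_(i <- r | p i) \int[mu]_x f i x.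
Proof.
move=> If; elim: r => [|i r IHr].
  under eq_Rintegral do rewrite big_nil.
  by rewrite big_nil Rintegral_cst // mul0r.
rewrite big_cons; case: ifP => pi.
  under eq_Rintegral do rewrite big_cons pi.
  rewrite RintegralD ?IHr //; first exact: If.
  exact: integrable_real_sum.
by under eq_Rintegral do rewrite big_cons pi.
Qed.

End RealIntegrable.

Section NormalMoments.
Context {R : realType}.
Local Notation mu := (@lebesgue_measure R).
Local Notation phi := (@normal_pdf R 0 1).

Lemma normal_pdf01E x : phi x = normal_peak 1 * expR (- (x ^+ 2 / 2)).
Proof.
rewrite normal_pdfE ?oner_eq0 //= /normal_fun subr0 expr1n.
by rewrite mulNr.
Qed.

(** Makes [x phi] the derivative of [- phi], as the integration by parts requires. *)
Lemma is_derive_normal_pdf01 (x : R) : is_derive x 1 phi (- x * phi x).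
Proof.
have -> : phi = normal_peak 1 \*: (expR \o ((- 2^-1) \*: (id ^+ 2 : R -> R))).
  apply/funext => y; rewrite normal_pdf01E; congr (_ * expR _).
  by rewrite /= /GRing.scale /= mulNr mulrC.
have d1 := @is_deriveX R R id 2 x 1 1 (is_derive_id x 1).
have d2 := is_deriveZ (- 2^-1) d1.
have d3 := is_deriveZ (normal_peak 1) (is_derive1_comp (is_derive_expR _) d2).
apply: (is_derive_eq d3); rewrite /= /GRing.scale /= expr1.
by rewrite -[(id ^+ 2) x]/(x ^+ 2); field.
Qed.

(** The Radon-Nikodym derivative of the normal law agrees with [phi] almost everywhere, both having
    the same integral over every measurable set. *)
Lemma ge0_integral_normal_prob (h : R -> R) : measurable_fun setT h ->
  (forall x, 0 <= h x) ->
  (\int[normal_prob 0 1]_x (h x)%:E = \int[mu]_x (h x * phi x)%:E)%E.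
Proof.
move=> mh h0.
have dom := normal_prob_dominates 0 (1 : R).
have h0' x : (0 <= (EFin \o h) x)%E by rewrite lee_fin.
have mh' : measurable_fun setT (EFin \o h) by exact/measurable_EFinP.
rewrite -[LHS](Radon_Nikodym_SigmaFinite.change_of_variables dom h0' measurableT mh').
set rn := Radon_Nikodym_SigmaFinite.f _ _.
have irn : mu.-integrable setT rn := Radon_Nikodym_SigmaFinite.f_integrable dom.
apply: ae_eq_integral => //.
- apply: emeasurable_funM; [exact/measurable_EFinP|exact: measurable_int irn].
- apply/measurable_EFinP; apply: measurable_funM => //.
  exact: measurable_normal_pdf.
apply: (@ae_eqe_mul2l _ _ _ mu setT rn (EFin \o phi) (EFin \o h)).
apply: integral_ae_eq => //.
  by apply/measurable_EFinP; exact: measurable_normal_pdf.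
by move=> E _ mE; rewrite -(Radon_Nikodym_SigmaFinite.f_integral dom).
Qed.

(** The boundary term of the integration by parts; exponents up to 3 suffice for the fourth
    moment. *)
Lemma cvg_pow_normal_pdf01 k : (k <= 3)%N ->
  (n.+1%:R ^+ k * phi n.+1%:R) @[n --> \oo] --> (0 : R).
Proof.
move=> k3.
have p0 : 0 < normal_peak (1 : R) by rewrite normal_peak_gt0 ?oner_eq0.
apply: (@squeeze_cvgr _ _ _ _ (fun=> 0) (fun n => 16 * normal_peak 1 * harmonic n)).
- apply: nearW => n; rewrite normal_pdf01E.
  set x : R := n.+1%:R; have x1 : 1 <= x by rewrite ler1n.
  have x0 : 0 < x by exact: lt_le_trans x1.
  rewrite mulr_ge0 ?exprn_ge0 ?mulr_ge0 ?expR_ge0 ?(ltW p0) ?(ltW x0) //=.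
  rewrite mulrCA [leRHS]mulrAC [leRHS]mulrC ler_pM2l //.
  have xk : x ^+ k <= x ^+ 3 by rewrite ler_weXn2l.
  apply: (le_trans (ler_wpM2r (expR_ge0 _) xk)).
  rewrite expRN ler_pdivrMr ?expR_gt0 // -/x.
  (* Squaring [x^2 / 4 <= exp (x^2 / 4)] gives [x^4 / 16 <= exp (x^2 / 2)]: this is the origin of
     the constant 16, and it leaves a spare factor [1 / x]. *)
  have -> : x ^+ 2 / 2 = x ^+ 2 / 4 + x ^+ 2 / 4 by field.
  rewrite expRD.
  have e1 : 1 + x ^+ 2 / 4 <= expR (x ^+ 2 / 4) by exact: expR_ge1Dx.
  have e2 : x ^+ 2 / 4 <= expR (x ^+ 2 / 4) by rewrite (le_trans _ e1) // ler_wpDl.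
  have e3 : (x ^+ 2 / 4) ^+ 2 <= expR (x ^+ 2 / 4) ^+ 2.
    by rewrite lerXn2r ?nnegrE ?expR_ge0 // divr_ge0 ?sqr_ge0.
  rewrite -expr2; apply: (le_trans _ (ler_wpM2l _ e3)).
    by rewrite le_eqVlt; apply/orP; left; apply/eqP; field; rewrite gt_eqF.
  by rewrite mulr_ge0 // invr_ge0 ltW.
- exact: cvg_cst.
- suff : 16 * normal_peak 1 * harmonic n @[n --> \oo] --> (16 * normal_peak 1 * 0 : R).
    by rewrite mulr0.
  by apply: cvgMl_tmp; exact: cvg_harmonic.
Qed.

Lemma derivable_LRcontinuous (F : R -> R) a b :
  (forall x, derivable F x 1) -> derivable_oo_LRcontinuous F a b.
Proof.
move=> dF; have cF x : {for x, continuous F}.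
  exact/differentiable_continuous/derivable1_diffP.
split=> [x _||]; first exact: dF.
  by apply: cvg_at_right_filter; exact: cF.
by apply: cvg_at_left_filter; exact: cF.
Qed.

Lemma continuous_pow_normal_pdf01 k : continuous (fun x : R => x ^+ k * phi x).
Proof.
move=> x; apply: cvgM; first exact: exprn_continuous.
by apply: continuous_normal_pdf; rewrite oner_eq0.
Qed.

Lemma measurable_pow_normal_pdf01 k :
  measurable_fun setT (fun x : R => x ^+ k * phi x).
Proof.
by apply: continuous_measurable_fun; exact: continuous_pow_normal_pdf01.
Qed.

Lemma pow_normal_pdf01_ge0 k x : ~~ odd k -> 0 <= x ^+ k * phi x.
Proof.
move=> ek; apply: mulr_ge0; last exact: normal_pdf_ge0.
exact: exprn_even_ge0.
Qed.

Lemma normal_pdf01_by_parts k (b : R) : 0 < b -> ~~ odd k ->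
  (\int[mu]_(x in `[0%R, b]) (x ^+ k.+2 * phi x)%:E =
   (k.+1%:R)%:E * \int[mu]_(x in `[0%R, b]) (x ^+ k * phi x)%:E
   - (b ^+ k.+1 * phi b)%:E)%E.
Proof.
move=> b0 ek.
have dX (x : R) : is_derive x 1 (id ^+ k.+1 : R -> R) (k.+1%:R * x ^+ k).
  have := @is_deriveX R R id k.+1 x 1 1 (is_derive_id x 1).
  by move=> h; apply: (is_derive_eq h); rewrite /GRing.scale /= mulr1.
have dN (x : R) : is_derive x 1 (- phi) (x * phi x).
  have h := is_deriveN (is_derive_normal_pdf01 x).
  by apply: (is_derive_eq h); rewrite mulNr opprK.
have H1 : {within `[0, b], continuous (fun x : R => k.+1%:R * x ^+ k)}.
  apply: continuous_subspaceT => x.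
  by apply: cvgMl_tmp; exact: exprn_continuous.
have H2 : derivable_oo_LRcontinuous (id ^+ k.+1 : R -> R) 0 b.
  by apply: derivable_LRcontinuous => x.
have H3 : {in `]0, b[, (id ^+ k.+1 : R -> R)^`()%classic =1
    (fun x : R => k.+1%:R * x ^+ k)}.
  by move=> x _; rewrite derive1E derive_val.
have H4 : {within `[0, b], continuous (fun x : R => x * phi x)}.
  by apply: continuous_subspaceT; exact: (@continuous_pow_normal_pdf01 1).
have H5 : derivable_oo_LRcontinuous (- phi) 0 b.
  by apply: derivable_LRcontinuous => x.
have H6 : {in `]0, b[, (- phi)^`()%classic =1 (fun x : R => x * phi x)}.
  by move=> x _; rewrite derive1E derive_val.
have := integration_by_parts b0 H1 H2 H3 H4 H5 H6.
rewrite (_ : (fun x => _) = (fun x : R => (x ^+ k.+2 * phi x)%:E)); last first.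
  apply/funext => x; rewrite exprfctE mulrA.
  by rewrite [x ^+ k.+2]exprSr.
move=> ->; rewrite exprfctE.
rewrite [0 ^+ k.+1]exprS !mul0r subr0 -[(- phi) b]/(- phi b).
under eq_integral => x _.
  rewrite -[(- phi) x]/(- phi x) mulrN EFinN -mulrA EFinM; over.
rewrite integral_ge0N => [|x _]; last first.
  by rewrite -EFinM lee_fin mulr_ge0 ?pow_normal_pdf01_ge0.
rewrite ge0_integralZl_EFin //=.
- by rewrite oppeK addeC mulrN EFinN.
- by move=> x _; rewrite lee_fin pow_normal_pdf01_ge0.
- apply: measurable_funTS; apply/measurable_EFinP.
  exact: measurable_pow_normal_pdf01.
Qed.

(** In the integration by parts over [[0, n + 1]], monotone convergence handles both integrals and
    the boundary term tends to 0. Its exponent [k.+1] has to be at most 3, whence [k <= 2]. *)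
Lemma integral0y_pow_normal_pdf01S k c : (k <= 2)%N -> ~~ odd k ->
  (\int[mu]_(x in `[0%R, +oo[) (x ^+ k * phi x)%:E = c%:E)%E ->
  (\int[mu]_(x in `[0%R, +oo[) (x ^+ k.+2 * phi x)%:E = (k.+1%:R * c)%:E)%E.
Proof.
move=> k2 ek Ik.
have ek2 : ~~ odd k.+2 by rewrite /= negbK.
have ck j : ~~ odd j -> (\int[mu]_(x in `[0%R, n.+1%:R]) (x ^+ j * phi x)%:E)%E
    @[n --> \oo] --> (\int[mu]_(x in `[0%R, +oo[) (x ^+ j * phi x)%:E)%E.
  move=> ej; have := @ge0_cvgn_integral R mu (fun x => x ^+ j * phi x)
    (fun x => pow_normal_pdf01_ge0 x ej) (measurable_pow_normal_pdf01 j).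
  by rewrite -cvg_shiftS.
have c1 := ck _ ek2.
have c2 := ck _ ek.
have : (\int[mu]_(x in `[0%R, n.+1%:R]) (x ^+ k.+2 * phi x)%:E)%E
    @[n --> \oo] --> ((k.+1%:R)%:E * c%:E - 0%:E)%E.
  under eq_fun do rewrite normal_pdf01_by_parts //.
  apply: cvgeB; first by rewrite fin_num_adde_defl.
    by rewrite -Ik; apply: cvgeZl.
  by apply: cvg_EFin; [exact: nearW|exact: (@cvg_pow_normal_pdf01 k.+1)].
move/(cvg_unique _ c1) => -> //.
by rewrite sube0 EFinM.
Qed.

Lemma integral_pow_normal_pdf01 k : ~~ odd k ->
  (\int[mu]_x (x ^+ k * phi x)%:E =
   2%:E * \int[mu]_(x in `[0%R, +oo[) (x ^+ k * phi x)%:E)%E.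
Proof.
move=> ek; rewrite ge0_symfun_integralT.
- by congr (_ * _)%E; congr (integral _ _ _); rewrite set_itvcy.
- by move=> x; exact: pow_normal_pdf01_ge0.
- exact: continuous_pow_normal_pdf01.
- by move=> x /=; rewrite !normal_pdf01E sqrrN exprNn -signr_odd (negbTE ek) mul1r.
Qed.

Lemma normal01_moments : (\int[normal_prob 0 1]_x ((x : R) ^+ 2)%:E = 1)%E
  /\ (\int[normal_prob 0 1]_x ((x : R) ^+ 4)%:E = 3%:E)%E.
Proof.
have I0 : (\int[mu]_(x in `[0%R, +oo[) (x ^+ 0 * phi x)%:E = (2^-1)%:E)%E.
  set I := (\int[mu]_(_ in _) _)%E.
  have h : (1 = 2%:E * I :> \bar R)%E.
    rewrite -integral_pow_normal_pdf01 // -(integral_normal_pdf 0 1).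
    by apply: eq_integral => x _; rewrite expr0 mul1r.
  have -> : I = ((2^-1)%:E * (2%:E * I))%E.
    by rewrite muleA -EFinM mulVf // mul1e.
  by rewrite -h mule1.
(* The half-line moments of orders 0, 2, 4 are 1/2, 1/2 and 3/2; symmetry doubles them. *)
have I2 := integral0y_pow_normal_pdf01S (isT : 0 <= 2)%N isT I0.
have I4 := integral0y_pow_normal_pdf01S (isT : 2 <= 2)%N isT I2.
split; (rewrite ge0_integral_normal_prob => [|//|x]; last by rewrite exprn_even_ge0).
- rewrite (integral_pow_normal_pdf01 (isT : ~~ odd 2)) I2 -EFinM.
  by congr (_%:E); field.
- rewrite (integral_pow_normal_pdf01 (isT : ~~ odd 4)) I4 -EFinM.
  by congr (_%:E); field.
Qed.

(** Provides one dominating function, [1 + x^4], for all moments of order at most 4. *)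
Lemma norm_pow_le_quartic k (x : R) : (k <= 4)%N -> `|x| ^+ k <= 1 + x ^+ 4.
Proof.
move=> k4; have -> : x ^+ 4 = `|x| ^+ 4.
  by rewrite -normrX ger0_norm // exprn_even_ge0.
have [x1|x1] := leP `|x| 1.
  by rewrite (le_trans (exprn_ile1 _ _ x1)) // lerDl exprn_ge0.
by rewrite ler_wpDl // ler_weXn2l // ltW.
Qed.

Lemma integrable_normal01 (f : R -> R) : measurable_fun setT f ->
  (forall x, `|f x| <= 1 + x ^+ 4) ->
  (normal_prob 0 1).-integrable setT (EFin \o f).
Proof.
move=> mf f4.
refine (@integrable_dominated _ _ R (normal_prob 0 1) _ _ mf f4 _).
apply: integrable_realD; first exact: finite_measure_integrable_cst.
apply/integrableP; split; first exact/measurable_EFinP.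
under eq_integral do rewrite /= ger0_norm ?exprn_even_ge0 //.
by rewrite normal01_moments.2 ltry.
Qed.

(** Reflection exchanges the positive and negative parts; their common integral must be finite for
    the difference to be 0 in the extended reals. *)
Lemma normal01_mean : (\int[normal_prob 0 1]_x ((x : R))%:E = 0)%E.
Proof.
rewrite integralE.
have mneg : measurable_fun setT (-%R : measurableTypeR R -> measurableTypeR R) by [].
have E1 : (\int[normal_prob 0 1]_x ((EFin : R -> \bar R)^\+ x) =
           \int[normal_prob 0 1]_x (Num.max x 0)%:E)%E.
  by apply: eq_integral => x _; rewrite funeposE -EFin_max.
have E2 : (\int[normal_prob 0 1]_x ((EFin : R -> \bar R)^\- x) =
           \int[normal_prob 0 1]_x (Num.max (- x) 0)%:E)%E.
  by apply: eq_integral => x _; rewrite funenegE -EFinN -EFin_max.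
have mmax : measurable_fun setT (fun x : R => Num.max x 0).
  by apply: measurable_maxr.
have mmaxN : measurable_fun setT (fun x : R => Num.max (- x) 0).
  by apply: measurable_maxr.
have E3 : (\int[normal_prob 0 1]_x (Num.max x 0)%:E =
           \int[normal_prob 0 1]_x (Num.max (- x) 0 : R)%:E)%E.
  rewrite !ge0_integral_normal_prob //; last 2 first.
    by move=> x; rewrite le_max lexx orbT.
    by move=> x; rewrite le_max lexx orbT.
  pose oppR : measurableTypeR R -> measurableTypeR R := -%R.
  pose h (x : R) : \bar R := (Num.max x 0 * phi x)%:E.
  have mh : measurable_fun setT h.
    apply/measurable_EFinP; apply: measurable_funM => //.
    exact: measurable_normal_pdf.
  have h0 : {in setT, forall x, 0 <= h x}%E.
    by move=> x _; rewrite lee_fin mulr_ge0 ?normal_pdf_ge0 // le_max lexx orbT.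
  transitivity (\int[pushforward mu oppR]_x h x)%E.
    by apply: eq_measure_integral => A mA _; exact/esym/lebesgue_measureN.
  rewrite (@ge0_integral_pushforward _ _ _ _ R oppR mneg mu setT h measurableT mh h0).
  rewrite preimage_setT; apply: eq_integral => x _.
  by rewrite /h /= !normal_pdf01E sqrrN.
rewrite [X in (X - _)%E]E1 [X in (_ - X)%E]E2 E3 subee //.
have : (normal_prob 0 1).-integrable setT (EFin \o (fun x : R => Num.max (- x) 0)).
  apply: integrable_normal01 => // x.
  apply: (le_trans _ (norm_pow_le_quartic x (isT : 1 <= 4)%N)).
  by rewrite expr1 ger0_norm ?le_max ?lexx ?orbT // ge_max normr_ge0 -normrN ler_norm.
by move=> /integrable_fin_num; exact.
Qed.

End NormalMoments.

(** * Independence *)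

Section TupleRectangles.
Context {d : measure_display} {E : measurableType d} {n : nat}.

Definition tuple_rect (B : 'I_n -> set E) : set (n.-tuple E) :=
  [set t | forall i, B i (tnth t i)].

Definition tuple_rects : set (set (n.-tuple E)) :=
  [set A | exists2 B, (forall i, measurable (B i)) & A = tuple_rect B].

Lemma measurable_tuple_rect B : (forall i, measurable (B i)) ->
  measurable (tuple_rect B).
Proof.
move=> mB.
have -> : tuple_rect B = \bigcap_(i in setT) ((fun t => tnth t i) @^-1` B i).
  by apply/seteqP; split=> [t tB i _|t tB i]; exact: tB.
apply: fin_bigcap_measurable => // i _.
by rewrite -[X in measurable X]setTI; exact: measurable_tnth.
Qed.

Lemma measurable_tuple_rects : @measurable _ (n.-tuple E) = <<s tuple_rects >>.
Proof.
apply/seteqP; split; last first.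
  apply: smallest_sub; first exact: sigma_algebra_measurable.
  by move=> _ [B mB ->]; exact: measurable_tuple_rect.
apply: smallest_sub; first exact: smallest_sigma_algebra.
apply: (big_ind (fun S => S `<=` <<s tuple_rects >>)) => [//|A B sA sB|i _].
  by rewrite subUset.
move=> _ [B mB <-]; apply: sub_sigma_algebra.
exists (fun j => if j == i then B else setT).
  by move=> j; case: ifP.
rewrite setTI; apply/seteqP; split=> [t tB j|t /(_ i)]; last by rewrite eqxx.
by case: eqVneq => // ->.
Qed.

(** Rectangles are stable under intersection and generate the product sigma-algebra, so they
    determine a finite measure. *)
Lemma tuple_measure_unique (R : realType)
    (m1 m2 : {measure set (n.-tuple E) -> \bar R}) :
  (forall B, (forall i, measurable (B i)) ->
    m1 (tuple_rect B) = m2 (tuple_rect B)) ->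
  (m1 setT < +oo)%E -> forall A, measurable A -> m1 A = m2 A.
Proof.
move=> m12 m1oo A mA.
apply: (measure_unique tuple_rects (fun=> setT) measurable_tuple_rects) => //.
- move=> _ _ [B mB ->] [C mC ->]; exists (fun i => B i `&` C i).
    by move=> i; exact: measurableI.
  apply/seteqP; split=> [t [tB tC] i|t tBC]; first by split.
  by split=> i; have [] := tBC i.
- by move=> _; exists (fun=> setT) => //; apply/seteqP; split.
- exact: bigcup_const.
- by move=> _ [B mB ->]; exact: m12.
Qed.

End TupleRectangles.

Section IndependentPair.
Context {R : realType} {d : measure_display} {T : measurableType d}.
Variable P : probability T R.

(** Both sides are finite measures in [A]: the restriction of [P] to [H] transported by [W], and a
    multiple of the law of [W]. Agreement on rectangles therefore extends. *)
Lemma indep_tuple_event d' (E : measurableType d') n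
    (W : {mfun T >-> n.-tuple E}) (H : set T) : measurable H ->
  (forall B, (forall i, measurable (B i)) ->
    P (W @^-1` tuple_rect B `&` H) = (P (W @^-1` tuple_rect B) * P H)%E) ->
  forall A, measurable A -> P (W @^-1` A `&` H) = (P (W @^-1` A) * P H)%E.
Proof.
move=> mH PB A mA.
pose c : {nonneg R} := NngNum (fine_ge0 (measure_ge0 P H)).
have cE : (c%:num)%:E = P H by rewrite /= fineK // fin_num_measure.
pose m1 : {measure set (n.-tuple E) -> \bar R} := pushforward (mrestr P mH) W.
pose m2 : {measure set (n.-tuple E) -> \bar R} := mscale c (distribution P W).
have m2E B : m2 B = (P (W @^-1` B) * P H)%E by rewrite /m2 /= /mscale cE muleC.
have mW : measurable_fun setT W by [].
rewrite -m2E -[LHS]/(m1 mW A); apply: tuple_measure_unique => //.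
  by move=> B mB; rewrite m2E; exact: PB.
rewrite /m1 /= /pushforward /mrestr preimage_setT setTI.
by rewrite (le_lt_trans (probability_le1 P mH)) // ltry.
Qed.

Context {d1 d2 : measure_display} {E1 : measurableType d1}
  {E2 : measurableType d2}.
Variables (X : {mfun T >-> E1}) (Y : {mfun T >-> E2}).
Hypothesis indXY : forall A B, measurable A -> measurable B ->
  P (X @^-1` A `&` Y @^-1` B) = (P (X @^-1` A) * P (Y @^-1` B))%E.

(** Independence makes the law of the pair a product measure; Tonelli then gives integrability of
    the product and Fubini its integral. *)
Lemma indep_expectation (f : E1 -> R) (g : E2 -> R) :
  measurable_fun setT f -> measurable_fun setT g ->
  P.-integrable setT (EFin \o (f \o X)) ->
  P.-integrable setT (EFin \o (g \o Y)) ->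
  P.-integrable setT (EFin \o (fun w => f (X w) * g (Y w))) /\
  \int[P]_w (f (X w) * g (Y w)) = \int[P]_w f (X w) * \int[P]_w g (Y w).
Proof.
move=> mf mg If Ig.
have mXY : measurable_fun setT (fun w => (X w, Y w)) by exact: measurable_fun_pair.
pose XY : {mfun T >-> (E1 * E2)%type} :=
  HB.pack (fun w => (X w, Y w)) (isMeasurableFun.Build _ _ _ _ _ mXY).
pose m1 := distribution P X; pose m2 := distribution P Y.
have prodE A : measurable A -> (m1 \x m2)%E A = distribution P XY A.
  apply: product_measure_unique => B C mB mC.
  by rewrite -indXY //; congr (P _); apply/seteqP; split.
have mF : measurable_fun setT (fun z : E1 * E2 => (f z.1 * g z.2)%:E).
  apply/measurable_EFinP; apply: measurable_funM; exact: measurableT_comp.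
have If1 : m1.-integrable setT (EFin \o f).
  by apply: integrable_pushforward => //; exact/measurable_EFinP.
have Ig2 : m2.-integrable setT (EFin \o g).
  by apply: integrable_pushforward => //; exact/measurable_EFinP.
have IF : (m1 \x m2)%E.-integrable setT (fun z : E1 * E2 => (f z.1 * g z.2)%:E).
  apply/integrable12ltyP => //=.
  have [mf1 f1oo] := integrableP _ _ _ If1.
  have [mg2 g2oo] := integrableP _ _ _ Ig2.
  rewrite (eq_integral (fun x => (\int[m2]_y `|(g y)%:E|) * `|(f x)%:E|)%E); last first.
    move=> x _; rewrite muleC -ge0_integralZl //=.
      by apply: eq_integral => y _; rewrite normrM EFinM.
    by apply/measurable_EFinP; exact: measurableT_comp.
  rewrite ge0_integralZl //=; last 2 first.
    by apply/measurable_EFinP; exact: measurableT_comp.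
    exact: integral_ge0.
  by rewrite lte_mul_pinfty // ?integral_ge0 // ge0_fin_numE // integral_ge0.
have IP : P.-integrable setT (EFin \o (fun w => f (X w) * g (Y w))).
  apply/integrableP; split; first exact: (measurableT_comp mF mXY).
  have [_] := integrableP _ _ _ IF; apply: le_lt_trans.
  rewrite (eq_measure_integral (distribution P XY)); last first.
    by move=> A mA _; exact: prodE.
  by rewrite ge0_integral_pushforward //; exact: measurableT_comp.
split=> //; rewrite /Rintegral -fineM; last 2 first.
- by apply: (integrable_fin_num measurableT If).
- by apply: (integrable_fin_num measurableT Ig).
congr fine.
transitivity (\int[m1 \x m2]_z (f z.1 * g z.2)%:E)%E.
  rewrite [RHS](eq_measure_integral (distribution P XY)); last first.
    by move=> A mA _; exact: prodE.
  by rewrite integral_pushforward.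
have fg2 : (\int[m2]_y (g y)%:E)%E \is a fin_num.
  exact: (integrable_fin_num measurableT Ig2).
rewrite -integral12_prod_meas1 // /fubini_F /=.
transitivity (\int[m1]_x ((f x)%:E * \int[m2]_y (g y)%:E))%E.
  by apply: eq_integral => x _; rewrite -integralZl.
rewrite -(fineK fg2) integralZr // fineK //.
by rewrite !integral_pushforward //; exact/measurable_EFinP.
Qed.

End IndependentPair.

(** * Families of columns: blanking, independence and permutation *)

Section JointTuple.
Context {R : realType} {d : measure_display} {T : measurableType d}.
Variable P : probability T R.
Context {d' : measure_display} {E : measurableType d'} {n : nat}.
Implicit Types (X : 'I_n -> {mfun T >-> E}) (D : pred 'I_n).

Lemma integrable_comp d2 (E2 : measurableType d2) (Y : {mfun T >-> E2})
    (f : E2 -> R) : measurable_fun setT f ->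
  (distribution P Y).-integrable setT (EFin \o f) ->
  P.-integrable setT (EFin \o (f \o Y)).
Proof.
move=> mf /integrableP[mEf foo]; apply/integrableP; split.
  by apply/measurable_EFinP; exact: measurableT_comp.
rewrite ge0_integral_pushforward // in foo.
exact: measurableT_comp.
Qed.

Definition joint X (w : T) : n.-tuple E := [tuple X i w | i < n].

Lemma measurable_joint X : measurable_fun setT (joint X).
Proof.
apply/measurable_fun_tnthP => i.
rewrite (_ : _ \o _ = X i) //.
by apply/funext => w /=; rewrite tnth_mktuple.
Qed.

HB.instance Definition _ X :=
  isMeasurableFun.Build _ _ _ _ (joint X) (measurable_joint X).

Variable x0 : E.

(* Blanking columns instead of deleting them keeps all test matrices in one type. *)
Definition blank D (t : n.-tuple E) : n.-tuple E :=
  [tuple if D i then x0 else tnth t i | i < n].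

Lemma measurable_blank D : measurable_fun setT (blank D).
Proof.
apply/measurable_fun_tnthP => i; have [Di|Di] := boolP (D i).
  rewrite (_ : _ \o _ = cst x0) //.
  by apply/funext => t /=; rewrite tnth_mktuple Di.
rewrite (_ : _ \o _ = fun t => tnth t i); first exact: measurable_tnth.
by apply/funext => t /=; rewrite tnth_mktuple (negbTE Di).
Qed.

HB.instance Definition _ D :=
  isMeasurableFun.Build _ _ _ _ (blank D) (measurable_blank D).

Lemma blank_blank D1 D2 t : blank D1 (blank D2 t) = blank (predU D1 D2) t.
Proof.
apply: eq_from_tnth => i; rewrite !tnth_mktuple /=.
by case: (D1 i); case: (D2 i).
Qed.

Lemma tnth_blank1 i j t : j != i -> tnth (blank (pred1 i) t) j = tnth t j.
Proof. by move=> ji; rewrite tnth_mktuple /= (negbTE ji). Qed.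

Variable X : 'I_n -> {mfun T >-> E}.
Hypothesis indX : mutually_independent P (fun i w => X i w).

(** Blanking puts the constant [x0] in position [i], so the preimage of a rectangle is either empty
    or constrains the other columns only. *)
Lemma indep_blank i A B : measurable A -> measurable B ->
  P ((blank (pred1 i) \o joint X) @^-1` A `&` X i @^-1` B) =
  (P ((blank (pred1 i) \o joint X) @^-1` A) * P (X i @^-1` B))%E.
Proof.
move=> mA mB; apply: indep_tuple_event => // [|C mC].
  by rewrite -[X in measurable X]setTI; exact: measurable_funP.
have PE (C' : set E) : measurable C' ->
    P (\bigcap_l (X l @^-1` (if l == i then C' else C l))) =
    (fine (P (X i @^-1` C')) * \prod_(l | l != i) fine (P (X l @^-1` C l)))%:E.
  move=> mC'; rewrite indX => [|l]; last by case: ifP.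
  rewrite (bigD1 i) //= eqxx; congr (_ * _)%:E.
  by apply: eq_bigr => l /negbTE ->.
have Wrect : (blank (pred1 i) \o joint X) @^-1` tuple_rect C =
    [set w | C i x0] `&` \bigcap_l (X l @^-1` (if l == i then setT else C l)).
  apply/seteqP; split=> [w Cw|w [Ci Cw] l].
    split=> [|l _]; first by have := Cw i; rewrite /= !tnth_mktuple /= eqxx.
    case: eqVneq => // li.
    by have := Cw l; rewrite /= !tnth_mktuple /= (negbTE li).
  rewrite /= !tnth_mktuple /=; case: eqVneq => [->//|li].
  by have := Cw l I; rewrite /= (negbTE li).
rewrite Wrect; have [Ci|Ci] := pselect (C i x0); last first.
  rewrite (_ : [set _ | _] = set0) ?set0I ?measure0 ?mul0e //.
  by apply/seteqP; split.
rewrite (_ : [set _ | _] = setT) ?setTI; last by apply/seteqP; split.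
rewrite (_ : _ `&` _ = \bigcap_l (X l @^-1` (if l == i then B else C l))).
  rewrite !PE // preimage_setT probability_setT mul1r EFinM muleC fineK //.
  rewrite fin_num_measure // -[X in measurable X]setTI; exact: measurable_funP.
apply/seteqP; split=> [w [Cw Bw] l _|w Cw].
  by have := Cw l I; case: eqVneq => [->|].
split=> [l _|]; last by have := Cw i I; rewrite eqxx.
by have := Cw l I; case: eqVneq.
Qed.

(** Invariance of [g] under blanking expresses that it does not depend on column [i]. *)
Lemma indep_coord i (g : n.-tuple E -> R) (f : E -> R) :
  measurable_fun setT g -> measurable_fun setT f ->
  (forall t, g (blank (pred1 i) t) = g t) ->
  P.-integrable setT (EFin \o (g \o joint X)) ->
  P.-integrable setT (EFin \o (f \o X i)) ->
  P.-integrable setT (EFin \o (fun w => g (joint X w) * f (X i w))) /\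
  \int[P]_w (g (joint X w) * f (X i w)) =
  \int[P]_w g (joint X w) * \int[P]_w f (X i w).
Proof.
move=> mg mf gi Ig If.
have gE : g \o joint X = g \o (blank (pred1 i) \o joint X).
  by apply/funext => w /=; rewrite gi.
have := indep_expectation (indep_blank i) mg mf.
move=> /(_ _ If) []; first by rewrite -gE.
have -> : (fun w => g ((blank (pred1 i) \o joint X) w) * f (X i w)) =
    (fun w => g (joint X w) * f (X i w)).
  by apply/funext => w /=; rewrite gi.
by move=> H1 H2; split=> //; rewrite H2 /=; under eq_Rintegral do rewrite gi.
Qed.

Hypothesis idX : forall i j A, measurable A ->
  P (X i @^-1` A) = P (X j @^-1` A).

(** Both joint laws give a rectangle the same product of probabilities, with factors reordered by
    [s]. *)
Lemma exchangeable (s : {perm 'I_n}) (F : n.-tuple E -> \bar R) :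
  measurable_fun setT F -> (forall t, 0 <= F t)%E ->
  (\int[P]_w F (joint X w) = \int[P]_w F (joint (X \o s) w))%E.
Proof.
move=> mF F0.
rewrite -[LHS](@ge0_integral_distribution _ _ _ _ _ P (joint X)) //.
rewrite -[RHS](@ge0_integral_distribution _ _ _ _ _ P (joint (X \o s))) //.
apply: eq_measure_integral => A mA _; apply: tuple_measure_unique => //.
  move=> B mB.
  have E1 : joint X @^-1` tuple_rect B = \bigcap_i (X i @^-1` B i).
    apply/seteqP; split=> w Bw i; first by move=> _; have := Bw i; rewrite tnth_mktuple.
    by rewrite tnth_mktuple; exact: Bw.
  have E2 : joint (X \o s) @^-1` tuple_rect B =
      \bigcap_i (X i @^-1` B ((s^-1)%g i)).
    apply/seteqP; split=> w Bw i.
      by move=> _; have := Bw ((s^-1)%g i); rewrite tnth_mktuple /= permKV.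
    by rewrite tnth_mktuple /=; have := Bw (s i) I; rewrite /= permK.
  have E12 : P (joint X @^-1` tuple_rect B) = P (joint (X \o s) @^-1` tuple_rect B).
    rewrite E1 E2 !indX //; congr EFin.
    rewrite [RHS](reindex_inj (@perm_inj _ s)); apply: eq_bigr => i _.
    by rewrite permK; congr fine; exact: idX.
  exact: E12.
exact: le_lt_trans (probability_le1 _ measurableT) (ltry _).
Qed.

End JointTuple.

(** * Standard normal vectors *)

Section StandardNormalVector.
Context {R : realType} {d : measure_display} {T : measurableType d}.
Variable P : probability T R.
Context {n : nat}.
Implicit Types X Y : {RV P >-> n.-tuple R}.

Lemma measurable_coord (X : {mfun T >-> n.-tuple R}) j :
  measurable_fun setT (fun w => tnth (X w) j).
Proof. by apply: (measurableT_comp (measurable_tnth j)). Qed.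

Definition coordinate (X : {mfun T >-> n.-tuple R}) j : {mfun T >-> R} :=
  HB.pack (fun w => tnth (X w) j)
    (isMeasurableFun.Build _ _ _ _ _ (measurable_coord X j)).

(** Lets the results on families of independent columns apply to the coordinates of one normal
    vector. *)
Lemma joint_coord (X : {mfun T >-> n.-tuple R}) w : joint (coordinate X) w = X w.
Proof. by apply: eq_from_tnth => j; rewrite tnth_mktuple. Qed.

Lemma standard_normal_law X Y A : standard_normal_vector X ->
  standard_normal_vector Y -> measurable A -> P (X @^-1` A) = P (Y @^-1` A).
Proof.
move=> [NX indX] [NY indY] mA.
suff E B : (forall j, measurable (B j)) ->
    P (X @^-1` tuple_rect B) = P (Y @^-1` tuple_rect B).
  apply: (@tuple_measure_unique _ _ _ _ (distribution P X) (distribution P Y)) => //.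
  exact: le_lt_trans (probability_le1 _ measurableT) (ltry _).
move=> mB.
have bigcapE (Z : {RV P >-> n.-tuple R}) : Z @^-1` tuple_rect B =
    \bigcap_j ((fun w => tnth (Z w) j) @^-1` B j).
  by apply/seteqP; split=> [w ZB j _|w ZB j]; [exact: ZB|exact: ZB j I].
rewrite !bigcapE indX // indY //; congr EFin.
by apply: eq_bigr => j _; rewrite NX // NY.
Qed.

Lemma Rintegral_prob_cst (c : R) : \int[P]_w c = c.
Proof.
rewrite Rintegral_cst //.
exact: etrans (congr1 (GRing.mul c) (congr1 fine (probability_setT P))) (mulr1 c).
Qed.

Variable X : {RV P >-> n.-tuple R}.
Hypothesis NX : standard_normal_vector X.
Local Notation x w j := (tnth (X w) j).

Lemma measurable_coordR j :
  measurable_fun setT ((fun w => x w j) : T -> measurableTypeR R).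
Proof. exact: measurable_coord. Qed.

(* normal_prob lives on measurableTypeR R, whose display is not the one of R. *)
Let coordR j : {mfun T >-> measurableTypeR R} :=
  HB.pack ((fun w => x w j) : T -> measurableTypeR R)
    (isMeasurableFun.Build _ _ _ _ _ (measurable_coordR j)).

Lemma integral_coordR j (f : measurableTypeR R -> \bar R) :
  (\int[distribution P (coordR j)]_y f y = \int[normal_prob 0 1]_y f y)%E.
Proof.
by apply: eq_measure_integral => A mA _; exact: NX.1.
Qed.

Lemma integrable_coord j (f : R -> R) : measurable_fun setT f ->
  (forall y, `|f y| <= 1 + y ^+ 4) ->
  P.-integrable setT (EFin \o (fun w => f (x w j))).
Proof.
move=> mf f4; apply: (@integrable_comp _ _ _ P _ _ (coordR j) f mf).
have /integrableP[mEf foo] := integrable_normal01 mf f4.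
by apply/integrableP; split=> //; rewrite integral_coordR.
Qed.

Lemma expectation_coord j (f : R -> R) : measurable_fun setT f ->
  (forall y, `|f y| <= 1 + y ^+ 4) ->
  \int[P]_w f (x w j) = fine (\int[normal_prob 0 1]_y (f y)%:E)%E.
Proof.
move=> mf f4; congr fine; rewrite -(integral_coordR j).
rewrite integral_distribution //; first exact/measurable_EFinP.
exact: (integrable_coord j mf f4).
Qed.

Lemma mean_coord j : \int[P]_w (x w j) = 0.
Proof.
rewrite (@expectation_coord j id) ?normal01_mean // => y.
by have := norm_pow_le_quartic y (isT : 1 <= 4)%N.
Qed.

Lemma second_moment_coord j : \int[P]_w (x w j ^+ 2) = 1.
Proof.
rewrite (@expectation_coord j (fun y => y ^+ 2)) ?normal01_moments.1 // => y.
by rewrite normrX norm_pow_le_quartic.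
Qed.

Lemma fourth_moment_coord j : \int[P]_w (x w j ^+ 4) = 3.
Proof.
rewrite (@expectation_coord j (fun y => y ^+ 4)) ?normal01_moments.2 // => y.
by rewrite normrX norm_pow_le_quartic.
Qed.

Lemma integrable_quartic (f : T -> R) C : measurable_fun setT f ->
  (forall w, `|f w| <= C * (1 + \sum_j x w j ^+ 4)) ->
  P.-integrable setT (EFin \o f).
Proof.
move=> mf fC; apply: (integrable_dominated mf fC).
apply: integrable_realZ; apply: integrable_realD.
  exact: finite_measure_integrable_cst.
apply: integrable_real_sum => j _.
apply: (@integrable_coord j (fun y => y ^+ 4)) => // y.
by rewrite normrX norm_pow_le_quartic.
Qed.

Lemma pow4_le_sum w a : x w a ^+ 4 <= \sum_j x w j ^+ 4.
Proof.
rewrite (bigD1 a) //= lerDl; apply: sumr_ge0 => j _.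
by rewrite exprn_even_ge0.
Qed.

Lemma quartic_ge0 w : 0 <= \sum_j x w j ^+ 4.
Proof. by apply: sumr_ge0 => j _; rewrite exprn_even_ge0. Qed.

(** The inequality between arithmetic and geometric means, for two products and then inside each of
    them; the factor 1/4 is dropped. *)
Lemma norm_prod4_le (a b c e : R) :
  `|a * b * c * e| <= a ^+ 4 + b ^+ 4 + c ^+ 4 + e ^+ 4.
Proof.
have h (s t : R) : `|s * t| <= (s ^+ 2 + t ^+ 2) / 2.
  rewrite ler_norml; have := sqr_ge0 (s - t); have := sqr_ge0 (s + t); nra.
have -> : a * b * c * e = (a * b) * (c * e) by ring.
apply: (le_trans (h _ _)); rewrite !exprMn.
have h1 := le_trans (ler_norm _) (h (a ^+ 2) (b ^+ 2)).
have h2 := le_trans (ler_norm _) (h (c ^+ 2) (e ^+ 2)).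
have q (s : R) : 0 <= s ^+ 4 by rewrite exprn_even_ge0.
have qq (s : R) : (s ^+ 2) ^+ 2 = s ^+ 4 by ring.
rewrite !qq in h1 h2; have := q a; have := q b; have := q c; have := q e; lra.
Qed.

Lemma integrable_coord4 a b c e :
  P.-integrable setT (EFin \o (fun w => x w a * x w b * x w c * x w e)).
Proof.
apply: (@integrable_quartic _ 4).
  do 3 (apply: measurable_funM; last exact: measurable_coord).
  exact: measurable_coord.
move=> w; apply: (le_trans (norm_prod4_le _ _ _ _)).
have := pow4_le_sum w a; have := pow4_le_sum w b; have := pow4_le_sum w c.
have := pow4_le_sum w e; lra.
Qed.

Lemma integrable_coord3 a b c :
  P.-integrable setT (EFin \o (fun w => x w a * x w b * x w c)).
Proof.
apply: (@integrable_quartic _ 4).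
  do 2 (apply: measurable_funM; last exact: measurable_coord).
  exact: measurable_coord.
(* The missing factor is set to 1 and is absorbed by the constant term of the dominating
   function. *)
move=> w; have := norm_prod4_le (x w a) (x w b) (x w c) 1.
rewrite mulr1 expr1n => h; apply: (le_trans h).
have := pow4_le_sum w a; have := pow4_le_sum w b; have := pow4_le_sum w c.
have := quartic_ge0 w; lra.
Qed.

Lemma integrable_coord2 a b :
  P.-integrable setT (EFin \o (fun w => x w a * x w b)).
Proof.
apply: (@integrable_quartic _ 4).
  by apply: measurable_funM; exact: measurable_coord.
move=> w; have := norm_prod4_le (x w a) (x w b) 1 1.
rewrite !mulr1 expr1n => h; apply: (le_trans h).
have := pow4_le_sum w a; have := pow4_le_sum w b.
have := quartic_ge0 w; lra.
Qed.

Lemma indep_one_coordinate a (g : n.-tuple R -> R) (f : R -> R) :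
  measurable_fun setT g -> measurable_fun setT f ->
  (forall t, g (blank (0 : R) (pred1 a) t) = g t) ->
  P.-integrable setT (EFin \o (g \o X)) ->
  (forall y, `|f y| <= 1 + y ^+ 4) ->
  \int[P]_w (g (X w) * f (x w a)) = \int[P]_w g (X w) * \int[P]_w f (x w a).
Proof.
move=> mg mf ga Ig f4.
have jE : joint (coordinate X) = X by apply/funext => w; rewrite joint_coord.
have [||_] := @indep_coord _ _ _ P _ _ _ (0 : R) (coordinate X) NX.2 a g f mg mf ga.
- by rewrite jE.
- exact: (integrable_coord a mf f4).
by rewrite jE.
Qed.

Let id4 (y : R) : `|y| <= 1 + y ^+ 4.
Proof. by have := norm_pow_le_quartic y (isT : 1 <= 4)%N. Qed.

Lemma covariance_coord a b : \int[P]_w (x w a * x w b) = (a == b)%:R.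
Proof.
have [<-|ab] := eqVneq a b.
  by under eq_Rintegral do rewrite -expr2; exact: second_moment_coord.
under eq_Rintegral do rewrite mulrC.
rewrite (@indep_one_coordinate a (fun t => tnth t b) id) //.
- by rewrite mean_coord mulr0.
- exact: measurable_tnth.
- by move=> t; rewrite tnth_blank1 // eq_sym.
- exact: (@integrable_coord b id).
Qed.

(** An index different from the other three makes the expectation vanish, by independence and zero
    mean. Otherwise all four agree, which gives the fourth moment 3, or they form two distinct
    pairs, which gives 1. *)
Lemma isserlis_diag a c e : \int[P]_w (x w a * x w a * x w c * x w e) =
  (c == e)%:R + 2 * ((a == c)%:R * (a == e)%:R).
Proof.
have far (a' b' c' e' : 'I_n) : e' != a' -> e' != b' -> e' != c' ->
    \int[P]_w (x w a' * x w b' * x w c' * x w e') = 0.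
  move=> ea eb ec.
  rewrite (@indep_one_coordinate e' (fun t => tnth t a' * tnth t b' * tnth t c') id) //.
  - by rewrite mean_coord mulr0.
  - do 2 (apply: measurable_funM; last exact: measurable_tnth).
    exact: measurable_tnth.
  - by move=> t; rewrite !tnth_blank1 // eq_sym.
  - exact: integrable_coord3.
have [<-|ce] := eqVneq c e; last first.
  have [ae|ae] := eqVneq a e; last first.
    by rewrite far 1?eq_sym //= ; ring.
  rewrite -ae in ce *; rewrite [a == c]eq_sym (negbTE ce).
  transitivity (\int[P]_w (x w a * x w a * x w a * x w c)).
    by apply: eq_Rintegral => w _; ring.
  by rewrite far //=; ring.
have [<-|ac] := eqVneq a c.
  have -> : true%:R + 2 * (true%:R * true%:R) = 3 :> R by rewrite /=; ring.
  rewrite -(fourth_moment_coord a).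
  by apply: eq_Rintegral => w _; ring.
have -> : true%:R + 2 * (false%:R * false%:R) = 1 :> R by rewrite /=; ring.
transitivity (\int[P]_w (x w a * x w a * (x w c ^+ 2))).
  by apply: eq_Rintegral => w _; ring.
rewrite (@indep_one_coordinate c (fun t => tnth t a * tnth t a) (fun y => y ^+ 2)) //.
- by rewrite second_moment_coord covariance_coord eqxx mulr1.
- by apply: measurable_funM; exact: measurable_tnth.
- by move=> t; rewrite !tnth_blank1.
- exact: integrable_coord2.
- by move=> y; rewrite normrX norm_pow_le_quartic.
Qed.

(** Wick's formula, one term for each pairing of the indices. Reordering the factors brings a pair
    containing [a] to the front; if [a] occurs once, the expectation is 0. *)
Lemma isserlis a b c e : \int[P]_w (x w a * x w b * x w c * x w e) =
  (a == b)%:R * (c == e)%:R + (a == c)%:R * (b == e)%:R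
  + (a == e)%:R * (b == c)%:R.
Proof.
have [<-|ab] := eqVneq a b; first by rewrite isserlis_diag /=; ring.
rewrite /= mul0r add0r; have [<-|ac] := eqVneq a c.
  transitivity (\int[P]_w (x w a * x w a * x w b * x w e)).
    by apply: eq_Rintegral => w _; ring.
  by rewrite isserlis_diag [b == a]eq_sym !(negbTE ab) /=; ring.
rewrite /= mul0r add0r; have [<-|ae] := eqVneq a e.
  transitivity (\int[P]_w (x w a * x w a * x w b * x w c)).
    by apply: eq_Rintegral => w _; ring.
  by rewrite isserlis_diag (negbTE ab) /=; ring.
rewrite /= mul0r; transitivity (\int[P]_w (x w b * x w c * x w e * x w a)).
  by apply: eq_Rintegral => w _; ring.
rewrite (@indep_one_coordinate a (fun t => tnth t b * tnth t c * tnth t e) id) //.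
- by rewrite mean_coord mulr0.
- do 2 (apply: measurable_funM; last exact: measurable_tnth).
  exact: measurable_tnth.
- by move=> t; rewrite !tnth_blank1 // eq_sym.
- exact: integrable_coord3.
Qed.

(** An entry of [x x^T - I], the centred form of [x x^T]. *)
Definition dev a b (t : n.-tuple R) : R := tnth t a * tnth t b - (a == b)%:R.

Lemma measurable_dev a b : measurable_fun setT (dev a b).
Proof.
apply: measurable_funB => //; apply: measurable_funM; exact: measurable_tnth.
Qed.

Lemma integrable_dev a b : P.-integrable setT (EFin \o (dev a b \o X)).
Proof.
apply: integrable_realB; first exact: integrable_coord2.
exact: finite_measure_integrable_cst.
Qed.

Lemma mean_dev a b : \int[P]_w dev a b (X w) = 0.
Proof.
rewrite RintegralB //.
- by rewrite covariance_coord Rintegral_prob_cst subrr.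
- exact: integrable_coord2.
- exact: finite_measure_integrable_cst.
Qed.

(** Centring removes from Wick's formula the pairing of [a] with [b] and [c] with [e]. *)
Lemma covariance_dev a b c e :
  P.-integrable setT (EFin \o (fun w => dev a b (X w) * dev c e (X w))) /\
  \int[P]_w (dev a b (X w) * dev c e (X w)) =
    (a == c)%:R * (b == e)%:R + (a == e)%:R * (b == c)%:R.
Proof.
pose F w := (x w a * x w b * x w c * x w e - (c == e)%:R * (x w a * x w b))
  - (a == b)%:R * dev c e (X w).
have FE : (fun w => dev a b (X w) * dev c e (X w)) = F.
  by apply/funext => w; rewrite /F /dev; ring.
have I1 := integrable_coord4 a b c e.
have I2 := integrable_realZ (c == e)%:R (integrable_coord2 a b).
have I3 := integrable_realZ (a == b)%:R (integrable_dev c e).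
have I12 := integrable_realB I1 I2.
rewrite FE; split; first exact: integrable_realB.
rewrite /F RintegralB // RintegralB // isserlis.
rewrite RintegralZl //; last exact: integrable_coord2.
rewrite RintegralZl //; last exact: integrable_dev.
by rewrite mean_dev covariance_coord; ring.
Qed.

End StandardNormalVector.

(** * Centred quadratic forms in one column, with coefficients depending on the others *)

Section CenteredForms.
Context {R : realType} {d : measure_display} {T : measurableType d}.
Variable P : probability T R.
Context {n k : nat}.

(** This is [x^T q x - tr q], written through centred variables so that expectations can be taken
    entry by entry. *)
Definition cform (q : 'M[R]_n) (t : n.-tuple R) : R :=
  \sum_a \sum_b q a b * dev a b t.

Lemma measurable_cform d' (S : measurableType d') (g : S -> 'M[R]_n)
    (h : S -> n.-tuple R) :
  (forall a b, measurable_fun setT (fun t => g t a b)) ->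
  measurable_fun setT h -> measurable_fun setT (fun t => cform (g t) (h t)).
Proof.
move=> mg mh; apply: measurable_sum => a; apply: measurable_sum => b.
apply: measurable_funM => //.
exact: measurableT_comp (measurable_dev a b) mh.
Qed.

Variable omega : 'I_k -> {RV P >-> n.-tuple R}.
Hypothesis hnormal : forall i, standard_normal_vector (omega i).
Hypothesis hindep : mutually_independent P (fun i w => omega i w).
Local Notation W := (joint omega).
Local Notation zero := ([tuple 0 | _ < n] : n.-tuple R).

Variables (i : 'I_k) (g : k.-tuple (n.-tuple R) -> 'M[R]_n) (C : R).
Hypothesis mg : forall a b, measurable_fun setT (fun t => g t a b).
Hypothesis gi : forall t, g (blank zero (pred1 i) t) = g t.
Hypothesis gC : forall t a b, `|g t a b| <= C.

(** For each entry, the coefficient [y * g a b] does not depend on column [i], so independence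
    separates it from a factor of mean zero. *)
Lemma mean_cform (y : k.-tuple (n.-tuple R) -> R) :
  measurable_fun setT y -> (forall t, y (blank zero (pred1 i) t) = y t) ->
  P.-integrable setT (EFin \o (fun w => y (W w) ^+ 2)) ->
  P.-integrable setT
    (EFin \o (fun w => y (W w) * cform (g (W w)) (omega i w))) /\
  \int[P]_w (y (W w) * cform (g (W w)) (omega i w)) = 0.
Proof.
move=> my yi y2.
have term a b : P.-integrable setT
      (EFin \o (fun w => (y (W w) * g (W w) a b) * dev a b (omega i w))) /\
    \int[P]_w ((y (W w) * g (W w) a b) * dev a b (omega i w)) = 0.
  have [||||I E] := @indep_coord _ _ _ P _ _ _ zero omega hindep i
    (fun t => y t * g t a b) (dev a b) _ (measurable_dev a b).
  - exact: measurable_funM.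
  - by move=> t; rewrite yi gi.
  (* Square integrability of [y] is enough, because [|y| <= 1 + y^2]. *)
  - apply: (integrable_dominated (g := fun w => C * (1 + y (W w) ^+ 2))).
    + apply: measurable_funM; first exact: measurableT_comp my _.
      exact: measurableT_comp (mg a b) _.
    + move=> w; rewrite /= normrM mulrC.
      apply: ler_pM => //; have := sqr_ge0 (`|y (W w)| - 1).
      have -> : y (W w) ^+ 2 = `|y (W w)| ^+ 2.
        by rewrite -normrX ger0_norm // sqr_ge0.
      have := sqr_ge0 `|y (W w)|; nra.
    + apply: integrable_realZ; apply: integrable_realD => //.
      exact: finite_measure_integrable_cst.
  - exact: (integrable_dev (hnormal i)).
  by split=> //; rewrite E mean_dev ?mulr0.
have E w : y (W w) * cform (g (W w)) (omega i w) =
    \sum_a \sum_b (y (W w) * g (W w) a b) * dev a b (omega i w).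
  rewrite /cform mulr_sumr; apply: eq_bigr => a _.
  by rewrite mulr_sumr; apply: eq_bigr => b _; rewrite mulrA.
have EF : (fun w => y (W w) * cform (g (W w)) (omega i w)) =
    (fun w => \sum_a \sum_b (y (W w) * g (W w) a b) * dev a b (omega i w)).
  exact/funext.
have I2 a : P.-integrable setT (EFin \o (fun w =>
    \sum_b (y (W w) * g (W w) a b) * dev a b (omega i w))).
  by apply: integrable_real_sum => b _; exact: (term a b).1.
rewrite EF; split; first by apply: integrable_real_sum => a _; exact: I2.
rewrite Rintegral_sum => [|a _]; last exact: I2.
rewrite big1 // => a _; rewrite Rintegral_sum => [|b _]; last exact: (term a b).1.
by rewrite big1 // => b _; exact: (term a b).2.
Qed.

(** In the fourfold sum the covariances keep only [(c, e) = (a, b)] and [(c, e) = (b, a)]; by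
    symmetry of [g] both contribute the square of [g a b], hence the factor 2. *)
Lemma second_moment_cform : (forall t, (g t)^T = g t) ->
  P.-integrable setT (EFin \o (fun w => cform (g (W w)) (omega i w) ^+ 2)) /\
  \int[P]_w (cform (g (W w)) (omega i w) ^+ 2) =
  2 * \int[P]_w (\sum_a \sum_b g (W w) a b ^+ 2).
Proof.
move=> gsym.
have Igg a b c e : P.-integrable setT (EFin \o (fun w => g (W w) a b * g (W w) c e)).
  apply: (integrable_dominated (g := fun=> C * C)).
  - by apply: measurable_funM; [exact: measurableT_comp (mg a b) _|
      exact: measurableT_comp (mg c e) _].
  - by move=> w; rewrite normrM ler_pM.
  - exact: finite_measure_integrable_cst.
pose G a b c e := \int[P]_w (g (W w) a b * g (W w) c e).
pose F a b c e w := (g (W w) a b * g (W w) c e) *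
  (dev a b (omega i w) * dev c e (omega i w)).
have term a b c e : P.-integrable setT (EFin \o F a b c e) /\
    \int[P]_w F a b c e w =
    G a b c e * ((a == c)%:R * (b == e)%:R + (a == e)%:R * (b == c)%:R).
  have [Idd Edd] := covariance_dev (hnormal i) a b c e.
  have [|||||I E] := @indep_coord _ _ _ P _ _ _ zero omega hindep i
    (fun t => g t a b * g t c e) (fun t => dev a b t * dev c e t).
  - exact: measurable_funM.
  - by apply: measurable_funM; exact: measurable_dev.
  - by move=> t; rewrite gi.
  - exact: Igg.
  - exact: Idd.
  by split=> //; rewrite /F E Edd.
have EF : (fun w => cform (g (W w)) (omega i w) ^+ 2) =
    (fun w => \sum_a \sum_b \sum_c \sum_e F a b c e w).
  apply/funext => w; rewrite expr2 {1}/cform mulr_suml; apply: eq_bigr => a _.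
  rewrite mulr_suml; apply: eq_bigr => b _.
  rewrite /cform mulr_sumr; apply: eq_bigr => c _.
  by rewrite mulr_sumr; apply: eq_bigr => e _; rewrite /F; ring.
have I1 a b c : P.-integrable setT (EFin \o (fun w => \sum_e F a b c e w)).
  by apply: integrable_real_sum => e _; exact: (term a b c e).1.
have I2 a b : P.-integrable setT (EFin \o (fun w => \sum_c \sum_e F a b c e w)).
  by apply: integrable_real_sum => c _; exact: I1.
have I3 a : P.-integrable setT
    (EFin \o (fun w => \sum_b \sum_c \sum_e F a b c e w)).
  by apply: integrable_real_sum => b _; exact: I2.
rewrite EF; split; first by apply: integrable_real_sum => a _; exact: I3.
have Isq a b : P.-integrable setT (EFin \o (fun w => g (W w) a b ^+ 2)).
  exact: Igg.
rewrite Rintegral_sum => [|a _]; last exact: I3.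
rewrite Rintegral_sum => [|a _]; last by apply: integrable_real_sum => b _; exact: Isq.
rewrite mulr_sumr; apply: eq_bigr => a _.
rewrite Rintegral_sum => [|b _]; last exact: I2.
rewrite Rintegral_sum => [|b _]; last exact: Isq.
rewrite mulr_sumr; apply: eq_bigr => b _.
rewrite Rintegral_sum => [|c _]; last exact: I1.
have inner c : \int[P]_w (\sum_e F a b c e w) =
    (a == c)%:R * G a b c b + (b == c)%:R * G a b c a.
  rewrite Rintegral_sum => [|e _]; last exact: (term a b c e).1.
  under eq_bigr do rewrite (term _ _ _ _).2 mulrDr.
  rewrite big_split /= (bigD1 b) //= [X in _ + X](bigD1 a) //= !eqxx.
  rewrite big1 => [|e eb]; last by rewrite [b == e]eq_sym (negbTE eb) /= mulr0 mulr0.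
  rewrite big1 => [|e ea]; last by rewrite [a == e]eq_sym (negbTE ea) /= mul0r mulr0.
  by rewrite /=; ring.
under eq_bigr do rewrite inner.
rewrite big_split /= (bigD1 a) //= [X in _ + X](bigD1 b) //= !eqxx.
rewrite big1 => [|c ca]; last by rewrite [a == c]eq_sym (negbTE ca) /= mul0r.
rewrite big1 => [|c cb]; last by rewrite [b == c]eq_sym (negbTE cb) /= mul0r.
have -> : G a b b a = G a b a b.
  by apply: eq_Rintegral => w _; rewrite -{2}gsym mxE.
have -> : \int[P]_w (g (W w) a b ^+ 2) = G a b a b by [].
by rewrite /=; ring.
Qed.

End CenteredForms.

(** * Nystrom approximations of random test matrices *)

Section NystromTestMatrix.
Context {R : realType}.

(** Since [J J^T = 1], the pseudoinverse of [J^T G J] is [J^T X J] with [X] that of [G], and the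
    factors [J] cancel. Inserting zero columns and permuting columns are both of this form. *)
Lemma nystrom_coisometry n p q (A : 'M[R]_n) (S : 'M[R]_(n, p))
    (J : 'M[R]_(p, q)) : psd A -> J *m J^T = 1%:M ->
  nystrom A (S *m J) = nystrom A S.
Proof.
move=> psdA JJ.
have [_ MPX _] := pinvmx_psd (gram_psd S psdA).
have [_ MPY _] := pinvmx_psd (gram_psd (S *m J) psdA).
rewrite /nystrom; set X := pinvmx_MP _ in MPX *.
rewrite (moore_penrose_unique MPY (Y := J^T *m X *m J)).
  by rewrite !trmx_mul !mulmxA -(mulmxA _ J J^T) JJ mulmx1
    -(mulmxA _ J J^T) JJ mulmx1.
have -> : (S *m J)^T *m A *m (S *m J) = J^T *m (S^T *m A *m S) *m J.
  by rewrite trmx_mul !mulmxA.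
move: (S^T *m A *m S) MPX => G [GXG XGX GXs XGs].
have GX : (J^T *m G *m J) *m (J^T *m X *m J) = J^T *m (G *m X) *m J.
  by rewrite !mulmxA -(mulmxA _ J J^T) JJ mulmx1.
have XG : (J^T *m X *m J) *m (J^T *m G *m J) = J^T *m (X *m G) *m J.
  by rewrite !mulmxA -(mulmxA _ J J^T) JJ mulmx1.
split; rewrite ?GX ?XG.
- by rewrite -[in RHS]GXG !mulmxA -(mulmxA _ J J^T) JJ mulmx1.
- by rewrite -[in RHS]XGX !mulmxA -(mulmxA _ J J^T) JJ mulmx1.
- by rewrite !trmx_mul trmxK -trmx_mul GXs !mulmxA.
- by rewrite !trmx_mul trmxK -trmx_mul XGs !mulmxA.
Qed.

Definition mx_of_cols n k (t : k.-tuple (n.-tuple R)) : 'M[R]_(n, k) :=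
  \matrix_(j, i) tnth (tnth t i) j.

Lemma nystrom_drop_blank n k (A : 'M[R]_n) (t : k.-tuple (n.-tuple R))
    (D : pred 'I_k) : psd A ->
  nystrom_drop A (mx_of_cols t) D =
  nystrom A (mx_of_cols (blank ([tuple 0 | _ < n] : n.-tuple R) D t)).
Proof.
move=> psdA; rewrite /nystrom_drop.
(* The rows of [J] are the unit vectors of the kept indices; multiplication by [J] reinserts the
   dropped columns as zeros. *)
pose J : 'M[R]_(#|[predC D]|, k) := \matrix_(b, l) (enum_val b == l)%:R.
rewrite -(@nystrom_coisometry _ _ _ A (drop_cols D (mx_of_cols t)) J) //.
  congr nystrom; apply/matrixP => a l.
  rewrite !mxE tnth_mktuple; have [Dl|Dl] := boolP (D l).
    rewrite tnth_mktuple big1 // => b _; rewrite !mxE.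
    have := enum_valP b; case: eqVneq => [->|_ _]; last by rewrite mulr0.
    by rewrite inE /= /in_mem /= Dl.
  have lD : l \in [predC D] by rewrite inE /= /in_mem /=.
  rewrite (bigD1 (enum_rank_in lD l)) //= !mxE enum_rankK_in // eqxx mulr1.
  rewrite big1 ?addr0 // => b bl; rewrite !mxE.
  case: eqVneq => [E|_]; last by rewrite mulr0.
  move/eqP: bl; case; apply: enum_val_inj.
  by rewrite enum_rankK_in.
apply/matrixP => b c; rewrite !mxE.
under eq_bigr do rewrite !mxE.
rewrite (bigD1 (enum_val b)) //= eqxx mul1r big1 ?addr0 => [|l lb].
  by rewrite (inj_eq enum_val_inj) eq_sym.
by rewrite [enum_val b == l]eq_sym (negbTE lb) mul0r.
Qed.

Definition permute_tuple (E : Type) k (s : 'S_k) (t : k.-tuple E) : k.-tuple E :=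
  [tuple tnth t (s i) | i < k].

Lemma nystrom_permute n k (A : 'M[R]_n) (s : 'S_k)
    (t : k.-tuple (n.-tuple R)) : psd A ->
  nystrom A (mx_of_cols (permute_tuple s t)) = nystrom A (mx_of_cols t).
Proof.
move=> psdA.
rewrite -(nystrom_coisometry (mx_of_cols t) (J := perm_mx (s^-1)%g) psdA).
  rewrite -col_permE; congr nystrom; apply/matrixP => a l.
  by rewrite !mxE tnth_mktuple.
by rewrite tr_perm_mx -perm_mxM mulgV perm_mx1.
Qed.

End NystromTestMatrix.

(** * Measurability and boundedness of [f] at a Nystrom approximation *)

Section MeasurableNystrom.
Context {R : realType} {n k : nat}.
Variables (A : 'M[R]_n) (f : R -> R).
Hypotheses (psdA : psd A) (fF : class_F f).

(** The functional calculus enters twice: for the pseudoinverse of the Gram matrix, and for [f]. *)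
Lemma measurable_matfun_nystrom :
  measurable_mx (fun t : k.-tuple (n.-tuple R) => matfun f (nystrom A (mx_of_cols t))).
Proof.
have mT : measurable_mx (fun t : k.-tuple (n.-tuple R) => mx_of_cols t).
  move=> j i; under eq_fun do rewrite mxE.
  exact: (measurableT_comp (measurable_tnth j) (measurable_tnth i)).
have mcst m p (B : 'M[R]_(m, p)) :=
  @measurable_mx_cst R _ (k.-tuple (n.-tuple R)) _ _ B.
have mS : measurable_mx (fun t : k.-tuple (n.-tuple R) =>
    (mx_of_cols t)^T *m A *m mx_of_cols t).
  by apply: measurable_mxM => //; apply: measurable_mxM => //; exact: measurable_mx_tr.
have mAT : measurable_mx (fun t : k.-tuple (n.-tuple R) => A *m mx_of_cols t).
  exact: measurable_mxM.
have mN : measurable_mx (fun t : k.-tuple (n.-tuple R) => nystrom A (mx_of_cols t)).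
  apply: measurable_mxM; last exact: measurable_mx_tr.
  apply: measurable_mxM => //.
  rewrite (_ : (fun t => _) = (fun t : k.-tuple (n.-tuple R) =>
      matfun GRing.inv ((mx_of_cols t)^T *m A *m mx_of_cols t))).
    apply: measurable_matfun => //; first by move=> t; exact: gram_psd.
      by move=> x x0; rewrite invr_ge0.
    exact: measurable_inv.
  by apply/funext => t; have [] := pinvmx_psd (gram_psd (mx_of_cols t) psdA).
have [_ f0 _] := fF.
have psdN (t : k.-tuple (n.-tuple R)) := nystrom_psd (mx_of_cols t) psdA.
(* [f] is unconstrained on negative numbers; [f (max x 0)] agrees with it on the spectrum and is
   nondecreasing on the whole line, hence Borel. *)
rewrite (_ : (fun t => _) = (fun t : k.-tuple (n.-tuple R) =>
    matfun (fun x => f (Num.max x 0)) (nystrom A (mx_of_cols t)))).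
  apply: measurable_matfun => //.
    by move=> x x0; rewrite f0 // le_max x0.
  apply: nondecreasing_measurable => // x y xy; apply: class_F_homo => //.
    by rewrite le_max lexx orbT.
  by rewrite ge_max !le_max xy lexx orbT.
apply/funext => t; apply: eq_matfun => // x x0.
by rewrite max_l.
Qed.

(** The bound is uniform in the test matrix, so the coefficients of the quadratic forms are bounded
    random variables. *)
Lemma matfun_nystrom_entry_bound (t : k.-tuple (n.-tuple R)) a b :
  `|matfun f (nystrom A (mx_of_cols t)) a b| <= \sum_c 2 * `|matfun f A c c|.
Proof.
have [psdB BC] := matfun_nystrom_bounds (mx_of_cols t) fF psdA.
apply: (le_trans (psd_entry_le a b psdB BC)).
have le c : matfun f A c c <= \sum_c `|matfun f A c c|.
  rewrite (bigD1 c) //= (le_trans (ler_norm _)) // lerDl.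
  exact: sumr_ge0.
by rewrite -mulr_sumr mulr_natl mulr2n lerD.
Qed.

End MeasurableNystrom.

(** * The mean squared error *)

Lemma expectation_Rintegral (R : realType) (d : measure_display)
    (T : measurableType d) (P : probability T R) (g : T -> R) :
  P.-integrable setT (EFin \o g) -> ('E_P[g] = (\int[P]_w g w)%R%:E)%E.
Proof.
by move=> Ig; rewrite unlock fineK //; exact: (integrable_fin_num measurableT Ig).
Qed.

Lemma frobenius_norm_sqr (R : realType) m n (M : 'M[R]_(m, n)) :
  frobenius_norm M ^+ 2 = \sum_i \sum_j M i j ^+ 2.
Proof.
rewrite sqr_sqrtr //; apply: sumr_ge0 => i _; apply: sumr_ge0 => j _.
exact: sqr_ge0.
Qed.

Lemma cformE (R : realType) n (q : 'M[R]_n) (t : n.-tuple R) :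
  cform q t = quad_form q (\col_j tnth t j) - \tr q.
Proof.
rewrite quad_formE /mxtrace -sumrB; apply: eq_bigr => a _.
under eq_bigr do rewrite /dev mulrBr.
rewrite sumrB; congr (_ - _).
  by apply: eq_bigr => b _; rewrite !mxE.
rewrite (bigD1 a) //= eqxx mulr1 big1 ?addr0 // => b ba.
by rewrite eq_sym (negbTE ba) mulr0.
Qed.

Lemma cformD (R : realType) n (q1 q2 : 'M[R]_n) (t : n.-tuple R) :
  cform (q1 + q2) t = cform q1 t + cform q2 t.
Proof.
rewrite /cform -big_split; apply: eq_bigr => a _ /=.
by rewrite -big_split; apply: eq_bigr => b _ /=; rewrite mxE mulrDl.
Qed.

Lemma norm_prod_le (R : realType) (x y : R) : `|x * y| <= x ^+ 2 + y ^+ 2.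
Proof.
rewrite ler_norml; have := sqr_ge0 (x + y); have := sqr_ge0 (x - y).
by have := sqr_ge0 x; have := sqr_ge0 y; nra.
Qed.

Lemma prod_le_half (R : realType) (x y : R) : x * y <= 2^-1 * (x ^+ 2 + y ^+ 2).
Proof. by have := sqr_ge0 (x - y); nra. Qed.

(** A product of two transpositions; the second fixes [i], because [s1 i2] and [j] both differ from
    [i]. *)
Lemma perm_two_points k (i1 i2 i j : 'I_k) : i1 != i2 -> i != j ->
  exists s : 'S_k, s i1 = i /\ s i2 = j.
Proof.
move=> i12 ij; pose s1 := tperm i1 i.
have s1i : s1 i1 = i by rewrite tpermL.
have s1i2 : s1 i2 != i by rewrite -[X in _ != X]s1i (inj_eq perm_inj) eq_sym.
exists (s1 * tperm (s1 i2) j)%g; rewrite !permM s1i tpermL; split=> //.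
by rewrite tpermD // eq_sym.
Qed.

(** * Errors of the single terms and their covariances *)

Section FlexTrace.
Context {R : realType} {d : measure_display} {T : measurableType d}.
Variable P : probability T R.
Context {n k : nat}.
Variables (A : 'M[R]_n) (f : R -> R).
Hypotheses (psdA : psd A) (fF : class_F f).
Variable omega : 'I_k -> {RV P >-> n.-tuple R}.
Hypothesis hnormal : forall i, standard_normal_vector (omega i).
Hypothesis hindep : mutually_independent P (fun i w => omega i w).

Local Notation V := (k.-tuple (n.-tuple R)).
Local Notation W := (joint omega).
Local Notation zero := ([tuple 0 | _ < n] : n.-tuple R).
Local Notation fA := (matfun f A).

Definition fnystrom (D : pred 'I_k) (t : V) : 'M[R]_n :=
  matfun f (nystrom A (mx_of_cols (blank zero D t))).

Lemma fnystrom_drop D t :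
  matfun f (nystrom_drop A (mx_of_cols t) D) = fnystrom D t.
Proof. by rewrite nystrom_drop_blank. Qed.

Lemma eq_fnystrom (D1 D2 : pred 'I_k) t : D1 =1 D2 ->
  fnystrom D1 t = fnystrom D2 t.
Proof.
move=> D12; congr (matfun _ (nystrom _ (mx_of_cols _))).
by apply: eq_from_tnth => l; rewrite !tnth_mktuple D12.
Qed.

Lemma fnystrom_blank (D D' : pred 'I_k) t : {subset D' <= D} ->
  fnystrom D (blank zero D' t) = fnystrom D t.
Proof.
move=> D'D; rewrite /fnystrom blank_blank; apply: eq_fnystrom => l /=.
by apply/orP/idP => [[//|/D'D]|]; [|left].
Qed.

Lemma measurable_fnystrom D a b :
  measurable_fun setT (fun t => fnystrom D t a b).
Proof.
have mf := measurable_matfun_nystrom psdA fF (k := k) a b.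
exact: (measurableT_comp mf (measurable_blank zero D)).
Qed.

Lemma fnystrom_sym D t : (fnystrom D t)^T = fnystrom D t.
Proof. exact/matfun_sym/nystrom_psd. Qed.

Lemma fA_sym : fA^T = fA.
Proof. exact: matfun_sym. Qed.

(** The order of the columns does not affect the approximation; only the set of removed labels is
    transported by [s]. *)
Lemma fnystrom_permute (s : 'S_k) (D D' : pred 'I_k) t :
  (forall l, D l = D' (s l)) -> fnystrom D (permute_tuple s t) = fnystrom D' t.
Proof.
move=> DD'; rewrite /fnystrom -[in RHS](nystrom_permute s _ psdA).
congr (matfun _ (nystrom _ (mx_of_cols _))).
by apply: eq_from_tnth => l; rewrite !tnth_mktuple DD'.
Qed.

Definition Mres (D : pred 'I_k) t := fA - fnystrom D t.
Definition Mdiff (D D' : pred 'I_k) t := fnystrom D' t - fnystrom D t.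

Lemma MresE D D' t : Mres D t = Mres D' t + Mdiff D D' t.
Proof. by rewrite /Mres /Mdiff addrA subrK. Qed.

Let C := 2 * \sum_a \sum_b `|fA a b| + 2 * \sum_c 2 * `|fA c c|.

Let entry_le a b : `|fA a b| <= \sum_a \sum_b `|fA a b|.
Proof.
rewrite (bigD1 a) //= (bigD1 b) //= -addrA lerDl addr_ge0 //.
  exact: sumr_ge0.
by apply: sumr_ge0 => ? _; exact: sumr_ge0.
Qed.

Let diag_ge0 : 0 <= \sum_c 2 * `|fA c c|.
Proof. by apply: sumr_ge0 => c _; rewrite mulr_ge0. Qed.

Let entries_ge0 : 0 <= \sum_a \sum_b `|fA a b|.
Proof. by apply: sumr_ge0 => a _; exact: sumr_ge0. Qed.

Lemma Mres_le D t a b : `|Mres D t a b| <= C.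
Proof.
rewrite !mxE (le_trans (ler_normB _ _)) //.
have h1 := entry_le a b.
have h2 := matfun_nystrom_entry_bound psdA fF (blank zero D t) a b.
rewrite /C; have := diag_ge0; have := entries_ge0.
by rewrite -/(fnystrom D t) in h2; lra.
Qed.

Lemma Mdiff_le D D' t a b : `|Mdiff D D' t a b| <= C.
Proof.
rewrite !mxE (le_trans (ler_normB _ _)) //.
have h1 := matfun_nystrom_entry_bound psdA fF (blank zero D t) a b.
have h2 := matfun_nystrom_entry_bound psdA fF (blank zero D' t) a b.
rewrite /C; have := diag_ge0; have := entries_ge0.
by rewrite -/(fnystrom D t) in h1; rewrite -/(fnystrom D' t) in h2; lra.
Qed.

Lemma measurable_Mres D a b : measurable_fun setT (fun t => Mres D t a b).
Proof.
under eq_fun do rewrite !mxE.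
by apply: measurable_funB => //; exact: measurable_fnystrom.
Qed.

Lemma measurable_Mdiff D D' a b :
  measurable_fun setT (fun t => Mdiff D D' t a b).
Proof.
under eq_fun do rewrite !mxE.
by apply: measurable_funB; exact: measurable_fnystrom.
Qed.

Lemma Mres_sym D t : (Mres D t)^T = Mres D t.
Proof. by rewrite /Mres [LHS]linearB /= fA_sym fnystrom_sym. Qed.

Lemma Mdiff_sym D D' t : (Mdiff D D' t)^T = Mdiff D D' t.
Proof. by rewrite /Mdiff [LHS]linearB /= !fnystrom_sym. Qed.

Definition sqnorm (M : 'M[R]_n) : R := \sum_a \sum_b M a b ^+ 2.

Lemma measurable_sqnorm (g : V -> 'M[R]_n) :
  (forall a b, measurable_fun setT (fun t => g t a b)) ->
  measurable_fun setT (fun t => sqnorm (g t)).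
Proof.
move=> mg; apply: measurable_sum => a; apply: measurable_sum => b.
exact: measurable_funX.
Qed.

Lemma sqnorm_ge0 M : 0 <= sqnorm M.
Proof. by apply: sumr_ge0 => a _; apply: sumr_ge0 => b _; exact: sqr_ge0. Qed.

Lemma integrable_sqnorm (g : V -> 'M[R]_n) c :
  (forall a b, measurable_fun setT (fun t => g t a b)) ->
  (forall t a b, `|g t a b| <= c) ->
  P.-integrable setT (EFin \o (fun w => sqnorm (g (W w)))).
Proof.
move=> mg gc; apply: integrable_real_sum => a _.
apply: integrable_real_sum => b _.
apply: (integrable_dominated (g := fun=> c ^+ 2)).
- by apply: measurable_funX; exact: measurableT_comp (mg a b) _.
- by move=> w; rewrite normrX lerXn2r ?nnegrE // (le_trans _ (gc (W w) a b)).
- exact: finite_measure_integrable_cst.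
Qed.

Lemma exchangeable_sqnorm (s : 'S_k) (g : V -> 'M[R]_n) :
  (forall a b, measurable_fun setT (fun t => g t a b)) ->
  \int[P]_w sqnorm (g (W w)) = \int[P]_w sqnorm (g (permute_tuple s (W w))).
Proof.
move=> mg; congr fine.
rewrite (@exchangeable _ _ _ P _ _ _ omega hindep _ s
  (fun t => (sqnorm (g t))%:E)).
- apply: eq_integral => w _; congr (sqnorm (g _))%:E.
  by apply: eq_from_tnth => l; rewrite !tnth_mktuple.
- by move=> i j B mB; exact: standard_normal_law.
- by apply/measurable_EFinP; exact: measurable_sqnorm.
- by move=> t; rewrite lee_fin sqnorm_ge0.
Qed.

Lemma exchange_Mres i j : \int[P]_w sqnorm (Mres (pred1 i) (W w)) =
  \int[P]_w sqnorm (Mres (pred1 j) (W w)).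
Proof.
pose s := tperm i j.
rewrite (@exchangeable_sqnorm s _ (measurable_Mres (pred1 i))).
apply: eq_Rintegral => w _; rewrite /Mres (@fnystrom_permute s _ (pred1 j)) // => l.
by rewrite /= -(inj_eq (@perm_inj _ s) l i) tpermL.
Qed.

Lemma exchange_Mdiff i1 i2 i j : i1 != i2 -> i != j ->
  \int[P]_w sqnorm (Mdiff (pred1 i1) (pred2 i1 i2) (W w)) =
  \int[P]_w sqnorm (Mdiff (pred1 i) (pred2 i j) (W w)).
Proof.
move=> i12 ij; have [s [s1 s2]] := perm_two_points i12 ij.
rewrite (@exchangeable_sqnorm s _ (measurable_Mdiff (pred1 i1) (pred2 i1 i2))).
apply: eq_Rintegral => w _; rewrite /Mdiff.
rewrite (@fnystrom_permute s (pred1 i1) (pred1 i)) => [|l]; last first.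
  by rewrite /= -s1 (inj_eq perm_inj).
rewrite (@fnystrom_permute s (pred2 i1 i2) (pred2 i j)) // => l.
by rewrite /= -s1 -s2 !(inj_eq perm_inj).
Qed.

Definition err (i : 'I_k) (w : T) : R :=
  cform (Mres (pred1 i) (W w)) (omega i w).

Lemma err_sqr i : P.-integrable setT (EFin \o (fun w => err i w ^+ 2)) /\
  \int[P]_w (err i w ^+ 2) = 2 * \int[P]_w sqnorm (Mres (pred1 i) (W w)).
Proof.
apply: (second_moment_cform hnormal hindep (measurable_Mres (pred1 i)) _
  (Mres_le (pred1 i)) (Mres_sym (pred1 i))).
by move=> t; rewrite /Mres fnystrom_blank.
Qed.

Lemma err_cross i j : i != j ->
  P.-integrable setT (EFin \o (fun w => err i w * err j w)) /\
  \int[P]_w (err i w * err j w) <=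
    \int[P]_w sqnorm (Mdiff (pred1 i) (pred2 i j) (W w)) +
    \int[P]_w sqnorm (Mdiff (pred1 j) (pred2 j i) (W w)).
Proof.
move=> ij; pose D := pred2 i j.
have Dji : pred2 j i =1 D by move=> l; rewrite /= orbC.
have sub_i : {subset pred1 i <= D} by move=> l /eqP ->; rewrite inE eqxx.
have sub_j : {subset pred1 j <= D} by move=> l /eqP ->; rewrite inE eqxx orbT.
(* [Mres D] ignores both columns [i] and [j], so [G l] sees only column [l] of the two; [H l] may
   depend on both. *)
pose G l t := cform (Mres D t) (tnth t l).
pose H l t := cform (Mdiff (pred1 l) D t) (tnth t l).
have WE l w : tnth (W w) l = omega l w by rewrite tnth_mktuple.
have mtnth l : measurable_fun setT (fun t : V => tnth t l) by exact: measurable_tnth.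
have mG l : measurable_fun setT (G l).
  by apply: measurable_cform => //; exact: measurable_Mres.
have invD l : l \in D -> forall t, Mres D (blank zero (pred1 l) t) = Mres D t.
  by move=> lD t; rewrite /Mres fnystrom_blank // => m /eqP ->.
have iD : i \in D by rewrite inE eqxx.
have jD : j \in D by rewrite inE eqxx orbT.
have IG2 l : l \in D -> P.-integrable setT (EFin \o (fun w => G l (W w) ^+ 2)).
  move=> lD; have [I2 _] := second_moment_cform hnormal hindep
    (measurable_Mres D) (invD l lD) (Mres_le D) (Mres_sym D).
  rewrite (_ : (fun w => _) = fun w => cform (Mres D (W w)) (omega l w) ^+ 2) //.
  by apply/funext => w; rewrite /G WE.
have IH2 l : l \in D ->
    P.-integrable setT (EFin \o (fun w => H l (W w) ^+ 2)) /\
    \int[P]_w (H l (W w) ^+ 2) = 2 * \int[P]_w sqnorm (Mdiff (pred1 l) D (W w)).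
  move=> lD; have inv t : Mdiff (pred1 l) D (blank zero (pred1 l) t) =
      Mdiff (pred1 l) D t.
    by rewrite /Mdiff !fnystrom_blank // => m /eqP ->.
  have := second_moment_cform hnormal hindep
    (measurable_Mdiff (pred1 l) D) inv (Mdiff_le (pred1 l) D) (Mdiff_sym (pred1 l) D).
  rewrite (_ : (fun w => H l (W w) ^+ 2) =
    fun w => cform (Mdiff (pred1 l) D (W w)) (omega l w) ^+ 2) //.
  by apply/funext => w; rewrite /H WE.
have Ginv l m : l \in D -> m \in D -> l != m ->
    forall t, G l (blank zero (pred1 m) t) = G l t.
  by move=> lD mD lm t; rewrite /G invD // tnth_blank1.
have cross l m : l \in D -> m \in D -> l != m ->
    P.-integrable setT (EFin \o (fun w => G l (W w) * err m w)) /\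
    \int[P]_w (G l (W w) * err m w) = 0.
  move=> lD mD lm; apply: (mean_cform hnormal hindep (measurable_Mres (pred1 m)) _
    (Mres_le (pred1 m)) (mG l) (Ginv l m lD mD lm) (IG2 l lD)).
  by move=> t; rewrite /Mres fnystrom_blank.
have crossG l m : l \in D -> m \in D -> l != m ->
    P.-integrable setT (EFin \o (fun w => G l (W w) * G m (W w))) /\
    \int[P]_w (G l (W w) * G m (W w)) = 0.
  move=> lD mD lm; have := mean_cform hnormal hindep (measurable_Mres D)
    (invD m mD) (Mres_le D) (mG l) (Ginv l m lD mD lm) (IG2 l lD).
  rewrite (_ : (fun w => G l (W w) * G m (W w)) =
    fun w => G l (W w) * cform (Mres D (W w)) (omega m w)) //.
  by apply/funext => w; rewrite {2}/G WE.
have errE l w : err l w = G l (W w) + H l (W w).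
  by rewrite /err (MresE _ D) cformD /G /H WE.
have ji : j != i by rewrite eq_sym.
have [I1 E1] := cross j i jD iD ji.
have [I2 E2] := cross i j iD jD ij.
have [I3 E3] := crossG i j iD jD ij.
have [I4 E4] := IH2 i iD.
have [I5 E5] := IH2 j jD.
have mH l : measurable_fun setT (H l).
  by apply: measurable_cform => //; exact: measurable_Mdiff.
have IHH : P.-integrable setT (EFin \o (fun w => H i (W w) * H j (W w))).
  apply: (integrable_dominated (g := fun w => H i (W w) ^+ 2 + H j (W w) ^+ 2)).
  - by apply: measurable_funM; [exact: measurableT_comp (mH i) _|
      exact: measurableT_comp (mH j) _].
  - by move=> w; exact: norm_prod_le.
  - exact: integrable_realD.
(* The identity [e_i e_j = h_i h_j + g_j e_i + g_i e_j - g_i g_j], whose last three terms have mean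
   zero. *)
have EE : (fun w => err i w * err j w) = (fun w =>
    (H i (W w) * H j (W w) + (G j (W w) * err i w + G i (W w) * err j w))
    - G i (W w) * G j (W w)).
  by apply/funext => w; rewrite !errE; ring.
have I12 := integrable_realD I1 I2.
have I12H := integrable_realD IHH I12.
rewrite EE; split; first exact: (integrable_realB I12H I3).
have EHH : \int[P]_w (H i (W w) * H j (W w) +
    (G j (W w) * err i w + G i (W w) * err j w) - G i (W w) * G j (W w)) =
    \int[P]_w (H i (W w) * H j (W w)).
  have -> := RintegralB measurableT I12H I3.
  have -> := RintegralD measurableT IHH I12.
  have -> := RintegralD measurableT I1 I2.
  have vanish (a b c e : R) : b = 0 -> c = 0 -> e = 0 -> a + (b + c) - e = a.
    by move=> -> -> ->; rewrite !addr0 subr0.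
  exact: vanish E1 E2 E3.
rewrite [leLHS]EHH.
have Eji : \int[P]_w sqnorm (Mdiff (pred1 j) (pred2 j i) (W w)) =
    \int[P]_w sqnorm (Mdiff (pred1 j) D (W w)).
  by apply: eq_Rintegral => w _; rewrite /Mdiff (eq_fnystrom _ Dji).
rewrite [X in _ <= _ + X]Eji; have I45 := integrable_realD I4 I5.
(* This 1/2 cancels the Gaussian factor 2 in the second moments of [H i] and [H j]. *)
apply: (@le_trans _ _ (\int[P]_w (2^-1 * (H i (W w) ^+ 2 + H j (W w) ^+ 2)))).
  apply: (le_Rintegral measurableT IHH (integrable_realZ _ I45)) => w _.
  exact: prod_le_half.
rewrite (RintegralZl _ measurableT I45) (RintegralD measurableT I4 I5) E4 E5.
by rewrite -mulrDr mulKf.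
Qed.

End FlexTrace.

Theorem theorem3p4 (R : realType) (d : measure_display) (T : measurableType d)
    (P : probability T R) (n k : nat) (hk : (2 <= k)%N) (hkn : (k <= n)%N)
    (A : 'M[R]_n) (hA : psd A) (f : R -> R) (hf : class_F f)
    (omega : 'I_k -> {RV P >-> n.-tuple R})
    (hnormal : forall i, standard_normal_vector (omega i))
    (hindep : mutually_independent P (fun i w => omega i w)) :
  let Om := test_matrix omega in
  let i1 : 'I_k := Ordinal (ltnW hk) in
  let i2 : 'I_k := Ordinal hk in
  let fA := matfun f A in
  let fA_1 := fun w => matfun f (nystrom_drop A (Om w) (pred1 i1)) in
  let fA_12 := fun w => matfun f (nystrom_drop A (Om w) (pred2 i1 i2)) in
  (MSE P (\tr fA) (fun w => iFlexTrace f A (Om w)) <=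
     (2 / k%:R)%:E * 'E_P[fun w => (frobenius_norm (fA - fA_1 w) ^+ 2)%R]
     + 2%:E * 'E_P[fun w => (frobenius_norm (fA_1 w - fA_12 w) ^+ 2)%R])%E.
Proof.
pose Om := test_matrix omega.
pose i1 : 'I_k := Ordinal (ltnW hk).
pose i2 : 'I_k := Ordinal hk.
pose fA := matfun f A.
pose fA_1 := fun w => matfun f (nystrom_drop A (Om w) (pred1 i1)).
pose fA_12 := fun w => matfun f (nystrom_drop A (Om w) (pred2 i1 i2)).
change (MSE P (\tr fA) (fun w => iFlexTrace f A (Om w)) <=
  (2 / k%:R)%:E * 'E_P[fun w => (frobenius_norm (fA - fA_1 w) ^+ 2)%R]
  + 2%:E * 'E_P[fun w => (frobenius_norm (fA_1 w - fA_12 w) ^+ 2)%R])%E.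
have OmE w : Om w = mx_of_cols (joint omega w).
  by apply/matrixP => a i; rewrite !mxE tnth_mktuple.
have i12 : i1 != i2 by [].
have k0 : (0 : R) < k%:R by rewrite ltr0n (ltnW hk).
pose e := err A f omega.
(* The traces of [f(A_{-i})] and of the residual add up to the trace of [f(A)], so each summand is
   the target plus its centred error. *)
have estE w : \tr fA - iFlexTrace f A (Om w) = - (k%:R^-1 * \sum_i e i w).
  rewrite /iFlexTrace.
  have -> : \sum_(i < k) (\tr (matfun f (nystrom_drop A (Om w) (pred1 i))) +
      quad_form (matfun f A - matfun f (nystrom_drop A (Om w) (pred1 i)))
        (col i (Om w))) = \sum_(i < k) (e i w + \tr fA).
    apply: eq_bigr => i _; rewrite /e /err cformE OmE fnystrom_drop //.
    have -> : col i (mx_of_cols (joint omega w)) = \col_j tnth (omega i w) j.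
      by apply/colP => j; rewrite !mxE tnth_mktuple.
    by rewrite /Mres -/fA linearB /=; ring.
  rewrite big_split /= sumr_const card_ord -mulr_natl; field.
  by rewrite gt_eqF.
pose m := \int[P]_w sqnorm (Mres A f (pred1 i1) (joint omega w)).
pose dl := \int[P]_w sqnorm (Mdiff A f (pred1 i1) (pred2 i1 i2) (joint omega w)).
have fA_1E w : fA_1 w = fnystrom A f (pred1 i1) (joint omega w).
  by rewrite -(fnystrom_drop f hA) -OmE.
have fA_12E w : fA_12 w = fnystrom A f (pred2 i1 i2) (joint omega w).
  by rewrite -(fnystrom_drop f hA) -OmE.
have E1 : ('E_P[fun w => (frobenius_norm (fA - fA_1 w) ^+ 2)%R] = m%:E)%E.
  rewrite -expectation_Rintegral; last first.
    apply: (integrable_sqnorm _ (measurable_Mres hA hf _) (Mres_le hA hf _)).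
  congr ('E_P[_])%E; apply/funext => w.
  by rewrite frobenius_norm_sqr fA_1E.
have E2 : ('E_P[fun w => (frobenius_norm (fA_1 w - fA_12 w) ^+ 2)%R] = dl%:E)%E.
  rewrite -expectation_Rintegral; last first.
    apply: (integrable_sqnorm _ (measurable_Mdiff hA hf _ _) (Mdiff_le hA hf _ _)).
  congr ('E_P[_])%E; apply/funext => w.
  rewrite frobenius_norm_sqr fA_1E fA_12E.
  (* This difference has the sign opposite to [Mdiff]. *)
  apply: eq_bigr => a _; apply: eq_bigr => b _.
  by rewrite !mxE -sqrrN opprB.
have Iee i j : P.-integrable setT (EFin \o (fun w => e i w * e j w)).
  have [<-|ij] := eqVneq i j; first exact: (err_sqr hA hf hnormal hindep i).1.
  exact: (err_cross hA hf hnormal hindep ij).1.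
have Isum i : P.-integrable setT (EFin \o (fun w => \sum_j e i w * e j w)).
  by apply: integrable_real_sum => j _; exact: Iee.
have sqE : (fun w => (\tr fA - iFlexTrace f A (Om w)) ^+ 2) =
    (fun w => k%:R^-1 ^+ 2 * \sum_i \sum_j e i w * e j w).
  apply/funext => w; rewrite estE sqrrN exprMn; congr (_ * _).
  rewrite expr2 mulr_suml; apply: eq_bigr => i _.
  by rewrite mulr_sumr.
have Isum2 : P.-integrable setT (EFin \o (fun w => \sum_i \sum_j e i w * e j w)).
  by apply: integrable_real_sum => i _; exact: Isum.
rewrite /MSE E1 E2 sqE expectation_Rintegral; last exact: integrable_realZ.
rewrite -!EFinM -EFinD lee_fin RintegralZl //.
have diag i : \int[P]_w (e i w * e i w) = 2 * m.
  have := (err_sqr hA hf hnormal hindep i).2.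
  by rewrite (exchange_Mres hA hf hnormal hindep i i1).
have offdiag i j : i != j -> \int[P]_w (e i w * e j w) <= 2 * dl.
  move=> ij; apply: (le_trans (err_cross hA hf hnormal hindep ij).2).
  have ji : j != i by rewrite eq_sym.
  have eq_le (x y : R) : x = y -> x <= y by move=> ->.
  rewrite mulr_natl mulr2n; apply: lerD; apply: eq_le; apply: esym.
    exact: (exchange_Mdiff hA hf hnormal hindep i12 ij).
  exact: (exchange_Mdiff hA hf hnormal hindep i12 ji).
have dl0 : 0 <= dl by apply: Rintegral_ge0 => w _; exact: sqnorm_ge0.
have total : \int[P]_w (\sum_i \sum_j e i w * e j w) <=
    k%:R * (2 * m + k%:R * (2 * dl)).
  have constE (c : R) : k%:R * c = \sum_(j < k) c.
    by rewrite sumr_const card_ord mulr_natl.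
  rewrite Rintegral_sum // constE; apply: ler_sum => i _.
  rewrite Rintegral_sum // (bigD1 i) //= diag lerD2l.
  (* The [k - 1] off-diagonal terms are completed to [k] equal ones, since [dl] is nonnegative;
     division by [k^2] then gives [2 m / k + 2 dl]. *)
  apply: (@le_trans _ _ (\sum_(j < k | j != i) 2 * dl)).
    by apply: ler_sum => j ji; apply: offdiag; rewrite eq_sym.
  by rewrite constE [leRHS](bigD1 i) //= lerDr mulr_ge0.
apply: (le_trans (ler_wpM2l _ total)); first by rewrite exprn_ge0 // invr_ge0 ltW.
rewrite le_eqVlt; apply/orP; left; apply/eqP; field.
by rewrite gt_eqF.
Qed.
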